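(* Let $A=kQ/I$, with the reduced Gröbner–Shirshov basis $\mathcal G$, $W=\mathrm{Tip}(\mathcal G)$, the weighted quiver $\overline{Q_B}$ of the reduced two-sided bar resolution, and the set of arrows $\mathcal M$, all as described in the context. Then $\mathcal M$ is a Morse matching of $\overline{Q_B}$. Moreover, for each $n\ge0$, a vertex $(w_1,\dots,w_n)$ of $\overline{Q_B}$ in homological degree $n$ is critical if and only if $(w_1,\dots,w_n)\in W^{(n-1)}$. Thus the set of critical vertices in degree $n$ is identified with the set $W^{(n-1)}$ of $(n-1)$-chains.
   Context: Quiver and order: - $k$ is a field and $Q$ a finite quiver. Paths are written left to right: $p=\alpha_1\cdots\alpha_r$ means $t(\alpha_i)=s(\alpha_{i+1})$. Vertices are paths of length $0$. - $\mathcal B$ is the set of all paths, $\mathcal B_+$ the set of paths of positive length, $Q_0$ the vertices and $Q_1$ the arrows. - Fix an admissible well-order $\prec$ on $\mathcal B$, i.e. a well-order compatible with multiplication of paths. For $0\ne r\in kQ$, $\mathrm{Tip}(r)$ is the $\prec$-largest path with nonzero coefficient in $r$. Ideal and Gröbner–Shirshov basis: - $I$ is a two-sided ideal of $kQ$ contained in the span of paths of length $\ge2$, and $A=kQ/I$. - $\mathrm{Tip}(I)=\{\mathrm{Tip}(r):0\ne r\in I\}$ and $\mathrm{NonTip}(I)=\mathcal B\setminus\mathrm{Tip}(I)$; the latter is a $k$-basis of $A$. - $\mathcal G$ is the reduced Gröbner–Shirshov basis of $I$: $\mathcal G\subseteq I$; $W:=\mathrm{Tip}(\mathcal G)$ generates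 the ideal $\langle\mathrm{Tip}(I)\rangle$; each $g\in\mathcal G$ has tip coefficient $1$; $g-\mathrm{Tip}(g)\in\mathrm{span}_k\mathrm{NonTip}(I)$; no element of $W$ is a factor of another. Ufnarovskiĭ graph and chains: - The Ufnarovskiĭ graph $Q_W$ has vertex set $Q_0\cup Q_1\cup\{u\in\mathcal B:u$ is a proper right factor of some $v\in W\}$. - Its arrows are the arrows $e\to x$ for $e\in Q_0$, $x\in Q_1$ with $x=ex$, together with the arrows $u\to v$ whenever $uv\in\mathcal B$, $uv\in\langle\mathrm{Tip}(I)\rangle$, and no proper left factor of $uv$ lies in $\langle\mathrm{Tip}(I)\rangle$. - For $i\ge0$, an $i$-chain is a sequence $(v_1,\dots,v_{i+1})\in\mathcal B_+^{i+1}$ such that $e\to v_1\to\cdots\to v_{i+1}$ is a path in $Q_W$ for some $e\in Q_0$. $W^{(i)}$ is the set of $i$-chains, and $W^{(-1)}=Q_0$. Bar resolution: - $E=\bigoplus_{e\in Q_0}ke$, $A_+=\mathrm{span}_k(\mathrm{NonTip}(I)\setminus Q_0)$ and $A^e=A\otimes_kA^{op}$. - The reduced bar resolution is $B(A,A)_0=A\otimes_EA$ and $B(A,A)_n=A\otimes_E A_+^{\otimes_En}\otimes_EA$. Writing $[a_1|\cdots|a_n]=1\otimes a_1\otimes\cdots\otimes a_n\otimes 1$, the differential is $$d[a_1|\cdots|a_n]=a_1[a_2|\cdots|a_n]+\sum_{i=1}^{n-1}(-1)^i[a_1|\cdots|a_ia_{i+1}|\cdots|a_n]+(-1)^n[a_1|\cdots|a_{n-1}]a_n.$$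 - It decomposes as $B(A,A)_n=\bigoplus A^e\cdot[w_1|\cdots|w_n]$, over sequences $(w_1,\dots,w_n)$ of elements of $\mathrm{NonTip}(I)\setminus Q_0$ with $w_1\cdots w_n$ a path. For $n=0$ the summands are $Ae\otimes eA$, $e\in Q_0$. The weighted quiver $\overline{Q_B}$: - Its vertices are these sequences, the degree-$0$ vertices being the elements of $Q_0$. Each vertex $(w_1,\dots,w_n)$ with $n\ge1$ has the following arrows. - An arrow $d_n^0$ to $(w_2,\dots,w_n)$ of weight $w_1\otimes1$. - For $1\le i\le n-1$, write $w_iw_{i+1}\equiv\sum_j\lambda_ju_j \bmod I$ with distinct $u_j\in\mathrm{NonTip}(I)\setminus Q_0$ and $\lambda_j\in k^*$. For each $j$ there is an arrow $d_n^i$ to $(w_1,\dots,w_{i-1},u_j,w_{i+2},\dots,w_n)$ of weight $(-1)^i\lambda_j\otimes1$. - An arrow $d_n^n$ to $(w_1,\dots,w_{n-1})$ of weight $(-1)^n\,1\otimes w_n$. - For $n=1$ the targets of $d_1^0$ and $d_1^1$ are the appropriate vertices $t(w_1)$ and $s(w_1)$ of $Q_0$. A weight $a\otimes b$ denotes the $A^e$-linear map sending the generator of the source summand to $a\cdot(\text{generator of the target summand})\cdot b$. - Parallel arrows are allowed; their weights sum to the corresponding component of $d$. The notions of partial matching, the quiver with dotted arrows, zigzag path, critical vertex and Morse matching apply verbatim, over the ring $A^e$. - Those notions are as follows. A partial matching is a set of arrows such that every vertex is incident to at most one of them, each with invertible weight. Reversing each matched arrow $a\to b$ of weight $\phi$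 into a dotted arrow $b\to a$ of weight $-\phi^{-1}$ gives $\overline{Q_B}^{\mathcal M}$. A zigzag path alternates dotted and thick arrows. A critical vertex is one incident to no matched arrow. A Morse matching is a partial matching such that, for every target $a$ of a matched arrow and every element $x$ of its summand, the sums over zigzag paths from $a$ to each vertex of the same degree that begin with a dotted arrow, of the composites of weights applied to $x$, exist and only finitely many are nonzero. The matching $\mathcal M$: - For $w\in\mathcal B$, $V_{w,i}$ is the set of vertices $(w_1,\dots,w_n)$ with $w_1\cdots w_n=w$ and $i\ge-1$ the largest integer such that $(w_1,\dots,w_{i+1})$ is an $i$-chain; here $i=-1$ when $w_1\notin Q_1$. - $\mathcal M$ is the set of arrows of $\overline{Q_B}$ of the form $$(w_1,\dots,w_{i+1},w'_{i+2},w''_{i+2},w_{i+3},\dots,w_n)\to(w_1,\dots,w_n),$$ where $(w_1,\dots,w_n)\in V_{w,i}$, $w'_{i+2}w''_{i+2}=w_{i+2}$ with $w'_{i+2},w''_{i+2}$ of positive length, and the source lies in $V_{w,i+1}$. *)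

(* Defs.v *)
From HB Require Import structures.
From Stdlib Require Import ClassicalEpsilon.
From mathcomp Require Import all_boot all_order all_algebra.
Set Implicit Arguments. Unset Strict Implicit. Unset Printing Implicit Defensive.
Import GRing.Theory.

(* formal finite k-linear combinations of elements of T; two of them are
   considered equal when their coefficient functions agree *)
Definition lc (k : Type) (T : Type) := seq (k * T).
Definition coef {k : fieldType} {T : eqType} (L : lc k T) (x : T) : k :=
  (\sum_(c <- L) (if c.2 == x then c.1 else 0))%R.
Definition lnull {k : fieldType} {T : eqType} (L : lc k T) : Prop :=
  forall x, coef L x = 0%R.
Definition lscale {k : fieldType} {T : Type} (c : k) (L : lc k T) : lc k T :=
  [seq ((c * x.1)%R, x.2) | x <- L].

(* Vertices of the weighted quiver of the bar resolution:
   inl e  = degree-0 vertex e in Q_0,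
   inr ws = the vertex (w_1,...,w_n), n >= 1. *)
Definition qbv (V Ar : Type) := (V + seq (V * seq Ar))%type.
(* an arrow of that quiver: ((source sequence, index i of d_n^i), target) *)
Definition qbarr (V Ar : Type) := (seq (V * seq Ar) * nat * qbv V Ar)%type.

Section PathAlgebra.
Context {k : fieldType} {V Ar : finType}.
Variables (s t : Ar -> V).

(* A path is written (start vertex, list of arrows, left to right);
   the vertex e (path of length 0) is (e, [::]). *)
Local Notation pth := (V * seq Ar)%type.

Definition valid (p : pth) : bool :=
  match p.2 with
  | [::] => true
  | a :: l => (s a == p.1) && path (fun x y => t x == s y) a l
  end.
Definition qend (p : pth) : V := last p.1 (map t p.2).
Definition composable (p q : pth) : bool := qend p == q.1.
Definition pcat (p q : pth) : pth := (p.1, p.2 ++ q.2).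
Definition pos_vert (p : pth) (i : nat) : V := last p.1 (map t (take i p.2)).
Definition subp (p : pth) (i j : nat) : pth :=
  (pos_vert p i, take (j - i) (drop i p.2)).
Definition factor (y p : pth) : Prop :=
  exists i j, (i <= j <= size p.2)%N /\ y = subp p i j.
Definition right_factor (y p : pth) : Prop :=
  exists i, (i <= size p.2)%N /\ y = subp p i (size p.2).

Definition kq (f : pth -> k) : Prop :=
  exists S : seq pth, forall p, f p != 0%R -> valid p && (p \in S).
Definition fadd (f g : pth -> k) : pth -> k := fun p => (f p + g p)%R.
Definition fscale (c : k) (f : pth -> k) : pth -> k := fun p => (c * f p)%R.
Definition fmul (f g : pth -> k) : pth -> k := fun q =>
  if valid q then
    (\sum_(i < (size q.2).+1)
        f (q.1, take i q.2) * g (pos_vert q i, drop i q.2))%R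
  else 0%R.

Definition two_sided_ideal (I : (pth -> k) -> Prop) : Prop :=
  [/\ forall f, I f -> kq f,
      I (fun _ => 0%R) /\ (forall f g, I f -> I g -> I (fadd f g)),
      forall c f, I f -> I (fscale c f),
      forall f g, I f -> kq g -> I (fmul g f) /\ I (fmul f g)
    & forall f p, I f -> (size p.2 < 2)%N -> f p = 0%R].

Variable lt : rel pth.

Definition admissible_order : Prop :=
  [/\ (forall p, valid p -> ~~ lt p p) /\
      (forall p q r, valid p -> valid q -> valid r -> lt p q -> lt q r -> lt p r),
      forall p q, valid p -> valid q -> p <> q -> lt p q || lt q p,
      forall P : pth -> Prop, (exists p, valid p /\ P p) ->
        exists m, [/\ valid m, P m & forall q, valid q -> P q -> ~~ lt q m],
      forall p q r, valid p -> valid q -> valid r -> lt p q ->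
        composable p r -> composable q r -> lt (pcat p r) (pcat q r)
    & forall p q r, valid p -> valid q -> valid r -> lt p q ->
        composable r p -> composable r q -> lt (pcat r p) (pcat r q)].

Definition is_tip (f : pth -> k) (p : pth) : Prop :=
  f p != 0%R /\ forall q, f q != 0%R -> q <> p -> lt q p.

Variable I : (pth -> k) -> Prop.

Definition TipI (p : pth) : Prop := exists f, I f /\ is_tip f p.
Definition NonTip (p : pth) : Prop := valid p /\ ~ TipI p.
Definition in_tip_ideal (p : pth) : Prop :=
  valid p /\ exists y, factor y p /\ TipI y.

Definition nf (L : lc k pth) : lc k pth :=
  epsilon (inhabits [::]) (fun L' : lc k pth =>
    (forall c, c \in L' -> NonTip c.2) /\
    I (fun p => coef L p - coef L' p)%R).
Definition nfc (p : pth) : pth -> k := coef (nf [:: (1%R, p)]).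
Definition lmul (a b : lc k pth) : lc k pth :=
  [seq ((x.1 * y.1)%R, pcat x.2 y.2)
     | x <- a, y <- [seq y <- b | composable x.2 y.2]].
Definition Amul (a b : lc k pth) : lc k pth := nf (lmul a b).
Definition oneA : lc k pth := [seq (1%R, (v, [::])) | v <- enum V].

Definition reduced_GS_basis (G : (pth -> k) -> Prop) : Prop :=
  let W := fun w => exists g, G g /\ is_tip g w in
  [/\ forall g, G g -> I g,
      forall g, G g -> exists w, is_tip g w /\ g w = 1%R,
      forall g w p, G g -> is_tip g w -> p <> w -> g p != 0%R -> NonTip p,
      forall p, in_tip_ideal p <-> valid p /\ exists w, W w /\ factor w p
    & forall w w', W w -> W w' -> factor w w' -> w = w'].

Variable G : (pth -> k) -> Prop.
Definition Wset (w : pth) : Prop := exists g, G g /\ is_tip g w.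

Definition qw_vert (u : pth) : Prop :=
  (exists e, u = (e, [::])) \/ (exists x, u = (s x, [:: x])) \/
  (exists v, Wset v /\ right_factor u v /\ u <> v).
Definition qw_arrow (u v : pth) : Prop :=
  qw_vert u /\ qw_vert v /\
  ((exists e x, [/\ u = (e, [::]), v = (s x, [:: x]) & s x = e]) \/
   [/\ valid u, valid v, composable u v, in_tip_ideal (pcat u v)
     & forall j, (j < size (pcat u v).2)%N ->
         ~ in_tip_ideal (subp (pcat u v) 0 j)]).
Fixpoint qchain (x : pth) (l : seq pth) : Prop :=
  match l with
  | [::] => True
  | y :: l' => qw_arrow x y /\ qchain y l'
  end.
Definition is_chain (i : nat) (vs : seq pth) : Prop :=
  [/\ size vs = i.+1,
      forall v, v \in vs -> valid v /\ (0 < size v.2)%N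
    & exists e, qchain (e, [::]) vs].
(* the vertex v of degree n lies in W^(n-1)  (W^(-1) = Q_0) *)
Definition in_W_chains (n : nat) (v : qbv V Ar) : Prop :=
  match n, v with
  | 0, inl _ => True
  | n'.+1, inr ws => is_chain n' ws
  | _, _ => False
  end.

Definition qdeg (v : qbv V Ar) : nat :=
  match v with inl _ => 0 | inr ws => size ws end.
Definition qb_vert (v : qbv V Ar) : Prop :=
  match v with
  | inl _ => True
  | inr ws => [/\ ws != [::],
                 forall w, w \in ws -> NonTip w /\ (0 < size w.2)%N
               & sorted composable ws]
  end.
Definition asrc (a : qbarr V Ar) : qbv V Ar := inr a.1.1.
Definition atgt (a : qbarr V Ar) : qbv V Ar := a.2.
Definition qb_arrow (a : qbarr V Ar) : Prop :=
  let: (ws, i, tg) := a in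
  qb_vert (inr ws) /\
  match ws with
  | [::] => False
  | w :: ws' =>
      (i = 0%N /\ tg = (if ws' is [::] then inl (qend w) else inr ws')) \/
      (i = size ws /\ tg = (if ws' is [::] then inl w.1 else inr (belast w ws'))) \/
      [/\ (0 < i)%N, (i < size ws)%N &
        exists u, nfc (pcat (nth w ws i.-1) (nth w ws i)) u != 0%R /\
                  tg = inr (take i.-1 ws ++ u :: drop i.+1 ws)]
  end.

(* weights: Wt c a b stands for c * (a (x) b) in A^e *)
Record wt := Wt { wc : k; wl : lc k pth; wr : lc k pth }.
Definition weight_of (a : qbarr V Ar) : wt :=
  let: (ws, i, tg) := a in
  match ws with
  | [::] => Wt 0 [::] [::]
  | w :: ws' =>
      if i == 0%N then Wt 1 [:: (1%R, w)] oneA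
      else if i == size ws then Wt ((-1) ^+ size ws)%R oneA [:: (1%R, last w ws')]
      else Wt ((-1) ^+ i * nfc (pcat (nth w ws i.-1) (nth w ws i))
                          (match tg with inr l => nth w l i.-1 | inl _ => w end))%R
              oneA oneA
  end.

(* Elements of the summand A^e.[w_1|...|w_n] ~ A s(w_1) (x)_k t(w_n) A are
   represented in the basis NonTip (x) NonTip. *)
Definition summ (v : qbv V Ar) (X : lc k (pth * pth)) : Prop :=
  forall p q, coef X (p, q) != 0%R ->
    [/\ NonTip p, NonTip q &
      match v with
      | inl e => qend p = e /\ q.1 = e
      | inr (w :: ws') => qend p = w.1 /\ q.1 = qend (last w ws')
      | inr [::] => False
      end].
Definition act (w : wt) (X : lc k (pth * pth)) : lc k (pth * pth) :=
  flatten [seq [seq ((wc w * x.1 * y.1 * z.1)%R, (y.2, z.2))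
                 | y <- Amul [:: (1%R, x.2.1)] (wl w),
                   z <- Amul (wr w) [:: (1%R, x.2.2)]] | x <- X].
Definition invertible_arrow (a : qbarr V Ar) : Prop :=
  [/\ forall X, summ (asrc a) X -> summ (atgt a) (act (weight_of a) X),
      forall X Y, summ (asrc a) X -> summ (asrc a) Y ->
        coef (act (weight_of a) X) =1 coef (act (weight_of a) Y) ->
        coef X =1 coef Y
    & forall Y, summ (atgt a) Y ->
        exists X, summ (asrc a) X /\ coef (act (weight_of a) X) =1 coef Y].
(* the dotted (reversed) arrow has weight  - phi^{-1} *)
Definition dot_act (a : qbarr V Ar) (Y : lc k (pth * pth)) : lc k (pth * pth) :=
  lscale (-1)%R (epsilon (inhabits [::]) (fun X =>
     summ (asrc a) X /\ coef (act (weight_of a) X) =1 coef Y)).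

Definition partial_matching (M : qbarr V Ar -> Prop) : Prop :=
  (forall a, M a -> qb_arrow a /\ invertible_arrow a) /\
  (forall a b, M a -> M b ->
     (asrc a = asrc b \/ asrc a = atgt b \/ atgt a = asrc b \/ atgt a = atgt b) ->
     a = b).

(* zigzag path: dotted m_1, thick r_1, dotted m_2, thick r_2, ... *)
Fixpoint zigzag_from (M : qbarr V Ar -> Prop) (cur : qbv V Ar)
    (g : seq (qbarr V Ar * qbarr V Ar)) (c : qbv V Ar) : Prop :=
  match g with
  | [::] => cur = c
  | (m, r) :: g' => [/\ M m /\ atgt m = cur, qb_arrow r, ~ M r, asrc r = asrc m
                       & zigzag_from M (atgt r) g' c]
  end.
Definition zigzag M a c g : Prop := g != [::] /\ zigzag_from M a g c.
Definition zz_val (g : seq (qbarr V Ar * qbarr V Ar)) (X : lc k (pth * pth)) :=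
  foldl (fun Y mr => act (weight_of mr.2) (dot_act mr.1 Y)) X g.

Definition morse_matching (M : qbarr V Ar -> Prop) : Prop :=
  partial_matching M /\
  forall m X, M m -> summ (atgt m) X ->
    exists F : qbv V Ar -> seq (seq (qbarr V Ar * qbarr V Ar)),
      [/\ forall c g, g \in F c -> zigzag M (atgt m) c g,
          forall c g, zigzag M (atgt m) c g -> ~ lnull (zz_val g X) -> g \in F c
        & exists C : seq (qbv V Ar), forall c, c \notin C ->
            lnull (flatten [seq zz_val g X | g <- undup (F c)])].

Definition critical (M : qbarr V Ar -> Prop) (v : qbv V Ar) : Prop :=
  qb_vert v /\ forall a, M a -> asrc a <> v /\ atgt a <> v.

(* (w_1,...,w_n) lies in V_{w,m-1}: m is the largest integer <= n such that
   (w_1,...,w_m) is an (m-1)-chain (m = 0 encodes i = -1) *)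
Definition chain_len (ws : seq pth) (m : nat) : Prop :=
  [/\ (m <= size ws)%N, m = 0%N \/ is_chain m.-1 (take m ws)
    & forall m', (m < m' <= size ws)%N -> ~ is_chain m'.-1 (take m' ws)].

Definition matchingM (a : qbarr V Ar) : Prop :=
  qb_arrow a /\
  exists ws m w' w'',
    [/\ [/\ atgt a = inr ws, qb_vert (inr ws), chain_len ws m & (m < size ws)%N],
        [/\ nth w' ws m = pcat w' w'', (0 < size w'.2)%N, (0 < size w''.2)%N &
          composable w' w''] &
        [/\ a.1.1 = take m ws ++ w' :: w'' :: drop m.+1 ws,
            chain_len a.1.1 m.+1 & a.1.2 = m.+1]].
End PathAlgebra.

(* Main.v *)
(* For nested paths, being in Tip(I) is monotone, so a vertex (w_1, ..., w_n) whose longest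
   chain prefix (w_1, ..., w_m) is proper falls into exactly one of two classes. If
   w_m w_{m+1} is in Tip(I) (or m = 0), then w_{m+1} = w' w'' with w' the shortest prefix that
   extends the chain, and the vertex is the target of exactly one matched arrow. Otherwise
   merging w_m and w_{m+1} is a matched arrow with this vertex as source. Full chains are
   critical. The weight of a matched arrow is a sign, since w' w'' is not in Tip(I).

   For the Morse condition, follow a basis element p (x) q of the summand of (w_1, ..., w_n)
   along a zigzag and consider the path T = p w_1 ... w_n q. Every thick arrow multiplies two
   neighbours of the sequence p, w_1, ..., w_n, q: if their product is in Tip(I), then T
   strictly decreases for the well-order. Otherwise T is unchanged and, unless the zigzag
   cannot be continued, either p becomes longer or p is kept and the longest chain prefix
   grows. Hence, by well-founded induction and finite branching, only finitely many zigzags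
   have a nonzero value. Working with T, and not with w_1 ... w_n, matters: an admissible order
   need not make proper factors smaller. *)
Require Import Defs.
From Stdlib Require Import ClassicalEpsilon FunctionalExtensionality.
From mathcomp Require Import all_boot all_order all_algebra.
Import GRing.Theory.

(** * Formal linear combinations, up to equality of coefficients *)

Section LinearCombinations.
Set Implicit Arguments. Unset Strict Implicit.
Variables (k : fieldType) (T : eqType).
Implicit Types (L : lc k T) (x : T).

Lemma coefE L x : coef L x = (\sum_(c <- L) c.1 * (c.2 == x)%:R)%R.
Proof. by apply: eq_bigr => c _; case: eqP; rewrite ?mulr1 ?mulr0. Qed.

Lemma coef_single (a : k) y x : coef [:: (a, y)] x = (if y == x then a else 0)%R.
Proof. by rewrite /coef big_seq1. Qed.

Lemma coef_cat L1 L2 x : coef (L1 ++ L2) x = (coef L1 x + coef L2 x)%R.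
Proof. by rewrite /coef big_cat. Qed.

Lemma coef_scale a L x : coef (lscale a L) x = (a * coef L x)%R.
Proof.
rewrite !coefE big_map big_distrr; apply: eq_bigr => c _ /=.
by rewrite mulrA.
Qed.

Lemma coef_neq0 L x : coef L x != 0%R -> x \in [seq c.2 | c <- L].
Proof.
apply: contraNT => /mapP xL; rewrite /coef big_seq big1 // => c cL.
by case: eqP => // cx; case: xL; exists c.
Qed.

Lemma coef_graph (g : T -> k) (r : seq T) x : uniq r ->
  coef [seq (g y, y) | y <- r] x = (if x \in r then g x else 0)%R.
Proof.
move=> Ur; rewrite /coef big_map /=; case: ifP => xr.
  by rewrite (bigD1_seq x) //= eqxx big1 ?addr0 // => y /negbTE ->.
rewrite big_seq big1 // => y yr.
by case: eqP => // yx; rewrite -yx yr in xr.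
Qed.

(** A formal combination may list an element several times; linear sums are regrouped along a
    duplicate-free list that covers its support. *)
Lemma sum_lc L (f : T -> k) (r : seq T) :
  uniq r -> {subset [seq c.2 | c <- L] <= r} ->
  (\sum_(c <- L) c.1 * f c.2 = \sum_(x <- r) coef L x * f x)%R.
Proof.
move=> Ur sLr; under [RHS]eq_bigr => x _ do rewrite coefE big_distrl.
rewrite exchange_big big_seq [RHS]big_seq; apply: eq_bigr => c cL /=.
rewrite (bigD1_seq c.2) ?Ur ?sLr ?map_f //= eqxx mulr1 big1 ?addr0 // => x.
by rewrite eq_sym => /negbTE ->; rewrite mulr0 mul0r.
Qed.

(** Regrouping both sums along one list covering both supports leaves only coefficients; elements
    whose occurrences cancel put no condition on [f] and [g]. *)
Lemma eq_sum_lc L L' (f g : T -> k) :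
  coef L =1 coef L' -> (forall x, coef L x != 0%R -> f x = g x) ->
  (\sum_(c <- L) c.1 * f c.2 = \sum_(c <- L') c.1 * g c.2)%R.
Proof.
move=> eLL' efg; pose r := undup [seq c.2 | c <- L ++ L'].
rewrite !(@sum_lc _ _ r) ?undup_uniq //; last 2 first.
- by move=> x xL; rewrite mem_undup map_cat mem_cat xL orbT.
- by move=> x xL; rewrite mem_undup map_cat mem_cat xL.
apply: eq_bigr => x _; rewrite -eLL'.
by have [->|/efg ->] := eqVneq (coef L x) 0%R; rewrite ?mul0r.
Qed.

(** This is how a nonzero value is traced back to a single basis element with nonzero
    coefficient. *)
Lemma sum_lc_neq0 L (f : T -> k) :
  (\sum_(c <- L) c.1 * f c.2 != 0)%R -> exists x, coef L x != 0%R /\ f x != 0%R.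
Proof.
rewrite (@sum_lc _ _ (undup [seq c.2 | c <- L])) ?undup_uniq; last 2 first.
- by [].
- by move=> x; rewrite mem_undup.
move=> S0; have [/hasP[x _ /andP[]]|/hasPn none] := boolP
  (has (fun x => (coef L x != 0%R) && (f x != 0%R)) (undup [seq c.2 | c <- L])).
  by exists x.
case/eqP: S0; rewrite big_seq big1 // => x /none.
by rewrite negb_and !negbK => /orP[]/eqP ->; rewrite ?mul0r ?mulr0.
Qed.

End LinearCombinations.

(** * Comparing decompositions of sequences, and finite unions *)

Section Sequences.
Set Implicit Arguments. Unset Strict Implicit.

Lemma cat_eq_prefix (T : eqType) (P S C R : seq T) :
  P ++ S = C ++ R -> (size P <= size C)%N ->
  exists E, C = P ++ E /\ S = E ++ R.
Proof.
move=> E PC; exists (drop (size P) C).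
have PE : P = take (size P) C.
  by move/(congr1 (take (size P))): E; rewrite take_size_cat // takel_cat.
split; first by rewrite {1}PE cat_take_drop.
move/(congr1 (drop (size P))): E; rewrite drop_size_cat // drop_cat => ->.
case: ltnP => // CP; have szE : size C = size P by apply/eqP; rewrite eqn_leq CP PC.
by rewrite -szE subnn drop0 drop_size.
Qed.

(** The finite-branching principle that bounds zigzags: finitely many choices, each with finitely
    many continuations. *)
Lemma finite_union (T1 T2 : eqType) (l : seq T1) (Q : T1 -> T2 -> Prop) :
  (forall d, d \in l -> exists Z : seq T2, forall e, Q d e -> e \in Z) ->
  exists Z : seq T2, forall d e, d \in l -> Q d e -> e \in Z.
Proof.
elim: l => [|d l IH] H; first by exists [::].
have [|Z HZ] := IH; first by move=> e el; apply: H; rewrite inE el orbT.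
have [|Z' HZ'] := H d; first by rewrite inE eqxx.
exists (Z' ++ Z) => d' e; rewrite inE mem_cat => /orP[/eqP ->|d'l] Qe.
  by rewrite HZ'.
by rewrite (HZ d') ?orbT.
Qed.

End Sequences.

(** * Paths of the quiver: concatenation, cutting, and products of sequences *)

Section Paths.
Set Implicit Arguments. Unset Strict Implicit.
Variables (V Ar : finType) (s t : Ar -> V).
Local Notation pth := (V * seq Ar)%type.
Local Notation valid := (valid s t).
Local Notation qend := (qend t).
Local Notation composable := (composable t).
Implicit Types (p q r : pth) (ws : seq pth).

Lemma valid_cons v a l : valid (v, a :: l) = (s a == v) && valid (t a, l).
Proof. by case: l => [|b l]; rewrite /valid //= [s b == t a]eq_sym. Qed.

Lemma valid_append v l1 l2 :
  valid (v, l1 ++ l2) = valid (v, l1) && valid (last v (map t l1), l2).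
Proof.
by elim: l1 v => [|a l1 IH] v //=; rewrite !valid_cons IH andbA.
Qed.

Lemma valid_pcat p q : composable p q -> valid (pcat p q) = valid p && valid q.
Proof.
case: p q => [v l] [w m] /eqP; rewrite /pcat /qend /= => vw.
by rewrite valid_append vw.
Qed.

Lemma qend_pcat p q : composable p q -> qend (pcat p q) = qend q.
Proof. by move=> /eqP pq; rewrite /qend /= map_cat last_cat -pq. Qed.

Lemma pcatA p q r : pcat p (pcat q r) = pcat (pcat p q) r.
Proof. by rewrite /pcat /= catA. Qed.

Lemma pcat_nil p v : pcat p (v, [::]) = p.
Proof. by case: p => w l; rewrite /pcat cats0. Qed.

Lemma composable_pcatl p q r :
  composable p q -> composable (pcat p q) r = composable q r.
Proof. by move=> pq; rewrite /composable qend_pcat. Qed.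

Lemma pcat_split p i :
  p = pcat (p.1, take i p.2) (pos_vert t p i, drop i p.2).
Proof. by case: p => v l; rewrite /pcat /= cat_take_drop. Qed.

Lemma composable_split p i l :
  composable (p.1, take i p.2) (pos_vert t p i, l).
Proof. exact: eqxx. Qed.

Lemma valid_split p i :
  valid p = valid (p.1, take i p.2) && valid (pos_vert t p i, drop i p.2).
Proof. by rewrite [in LHS](pcat_split p i) (valid_pcat (composable_split _ _ _)). Qed.

(** [pcat] forgets the start vertex of its second argument; composability recovers it as the end of
    the first. *)
Lemma pcat_inj p q p' q' : composable p q -> composable p' q' ->
  pcat p q = pcat p' q' -> size p.2 = size p'.2 -> p = p' /\ q = q'.
Proof.
move: p q p' q' => [v l] [w m] [v' l'] [w' m'] /eqP pq /eqP pq'.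
rewrite /pcat /= => -[vv' /eqP]; move: pq pq'; rewrite /qend /= => <- <- E szl.
by move: E; rewrite eqseq_cat // vv' => /andP[/eqP -> /eqP ->].
Qed.

(** The product of [x] with all members of [ws]; applied to p, w_1, ..., w_n, q it gives the path T
    that controls termination. *)
Definition total (x : pth) ws : pth := (x.1, x.2 ++ flatten (map snd ws)).

Lemma total_cons x y ws : total x (y :: ws) = pcat x (total y ws).
Proof. by []. Qed.

Lemma total_cat x y l m : total x (l ++ y :: m) = pcat (total x l) (total y m).
Proof. by rewrite /total /pcat map_cat flatten_cat /= !catA. Qed.

Lemma qend_total x l : path composable x l -> qend (total x l) = qend (last x l).
Proof.
elim: l x => [|y l IH] x /=; first by rewrite /total cats0; case: x.
by move=> /andP[xy /IH <-]; rewrite total_cons qend_pcat.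
Qed.

Lemma valid_total x l : path composable x l -> all valid (x :: l) ->
  valid (total x l).
Proof.
elim: l x => [|y l IH] x /=; first by rewrite andbT /total cats0; case: x.
move=> /andP[xy yl] /andP[vx vyl]; rewrite total_cons valid_pcat //.
by rewrite vx IH.
Qed.

End Paths.

Section BarResolution.
Set Implicit Arguments. Unset Strict Implicit.
Variables (k : fieldType) (V Ar : finType) (s t : Ar -> V).
Local Notation pth := (V * seq Ar)%type.
Variables (lt : rel pth) (I G : (pth -> k) -> Prop).
Hypothesis lt_adm : admissible_order s t lt.
Hypothesis I_ideal : two_sided_ideal s t I.
Hypothesis G_basis : reduced_GS_basis s t lt I G.
Local Notation valid := (valid s t).
Local Notation qend := (qend t).
Local Notation composable := (composable t).
Local Notation fmul := (fmul s t).
Local Notation TipI := (TipI lt I).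
Local Notation NonTip := (NonTip s t lt I).
Local Notation nf := (nf s t lt I).
Local Notation nfc := (nfc s t lt I).
Local Notation is_chain := (is_chain s t lt I G).
Local Notation qb_vert := (qb_vert s t lt I).
Local Notation qw_vert := (qw_vert s t lt G).
Local Notation qw_arrow := (qw_arrow s t lt I G).
Local Notation in_tip_ideal := (in_tip_ideal s t lt I).
Implicit Types (p q r u v w x y z : pth) (f g : pth -> k).
Implicit Types (o : option pth) (ws A B : seq pth).

(** * Admissible orders *)

Lemma lt_trans p q r : valid p -> valid q -> valid r ->
  lt p q -> lt q r -> lt p r.
Proof. by case: lt_adm => -[_ tr] _ _ _ _; apply: tr. Qed.

Lemma lt_total p q : valid p -> valid q -> p <> q -> lt p q || lt q p.
Proof. by case: lt_adm => _ tot _ _ _; apply: tot. Qed.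

Lemma lt_mulr p q r : valid p -> valid q -> valid r -> lt p q ->
  composable p r -> composable q r -> lt (pcat p r) (pcat q r).
Proof. by case: lt_adm => _ _ _ H _; apply: H. Qed.

Lemma lt_mull p q r : valid p -> valid q -> valid r -> lt p q ->
  composable r p -> composable r q -> lt (pcat r p) (pcat r q).
Proof. by case: lt_adm => _ _ _ _ H; apply: H. Qed.

(** A least counterexample exists by the minimum property of the order. The induction ranges over
    valid paths, where the order axioms hold. *)
Lemma lt_ind (P : pth -> Prop) :
  (forall p, valid p -> (forall q, valid q -> lt q p -> P q) -> P p) ->
  forall p, valid p -> P p.
Proof.
move=> IH p vp; apply: NNPP => nPp.
case: lt_adm => _ _ /(_ (fun q => ~ P q)) wf _ _.
have [|m [vm nPm minm]] := wf; first by exists p.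
apply: nPm; apply: IH => // q vq ltqm; apply: NNPP => nPq.
by have := minm q vq nPq; rewrite ltqm.
Qed.

Lemma max_path (l : seq pth) : l != [::] -> all valid l ->
  exists2 m, m \in l & forall q, q \in l -> q <> m -> lt q m.
Proof.
elim: l => [//|x l IH] _ /andP[vx vl].
have [l0|l0] := eqVneq l [::].
  rewrite l0; by exists x; rewrite ?inE // => q; rewrite inE => /eqP.
have [m ml mmax] := IH l0 vl.
have vm : valid m by apply: (allP vl).
have [xm|/eqP xm] := eqVneq x m.
  exists m; first by rewrite inE ml orbT.
  by move=> q; rewrite inE => /orP[/eqP ->|]; [rewrite xm|apply: mmax].
have /orP[ltxm|ltmx] := lt_total vx vm xm.
  exists m; first by rewrite inE ml orbT.
  by move=> q; rewrite inE => /orP[/eqP ->|] //; apply: mmax.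
exists x; first by rewrite inE eqxx.
move=> q; rewrite inE => /orP[/eqP ->|ql] // qx.
have [->//|/eqP qm] := eqVneq q m.
by apply: lt_trans (mmax q ql qm) ltmx => //; apply: (allP vl).
Qed.

(** * Tips and normal forms *)

Definition delta r : pth -> k := fun p => ((p == r)%:R)%R.

Lemma kq_delta r : valid r -> kq s t (delta r).
Proof.
move=> vr; exists [:: r] => p; rewrite /delta inE.
by have [->|] := eqVneq p r; rewrite ?vr ?eqxx.
Qed.

Lemma fmul_neq0 f g q : fmul f g q != 0%R ->
  exists y z, [/\ q = pcat y z, composable y z, valid q, f y != 0%R & g z != 0%R].
Proof.
rewrite /Defs.fmul; case: ifP => vq; last by rewrite eqxx.
have [i fgi _|none] := pickP (fun i : 'I_(size q.2).+1 =>
    f (q.1, take i q.2) * g (pos_vert t q i, drop i q.2) != 0)%R.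
  exists (q.1, take i q.2), (pos_vert t q i, drop i q.2); split=> //.
  - exact: pcat_split.
  - exact: composable_split.
  - by apply: contraNneq fgi => ->; rewrite mul0r.
  - by apply: contraNneq fgi => ->; rewrite mulr0.
by rewrite big1 ?eqxx // => i _; apply/eqP; rewrite -[_ == _]negbK none.
Qed.

(** A coefficient of a product is a sum over all cuts of the path; the last hypothesis kills every
    cut except the one after [y]. *)
Lemma fmul_pcat f g y z : composable y z -> valid (pcat y z) ->
  (forall y' z', pcat y' z' = pcat y z -> size y'.2 != size y.2 ->
     f y' * g z' = 0)%R ->
  fmul f g (pcat y z) = (f y * g z)%R.
Proof.
move=> cyz vyz off; rewrite /Defs.fmul vyz.
have szy : (size y.2 < (size (pcat y z).2).+1)%N.
  by rewrite ltnS size_cat leq_addr.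
rewrite (bigD1 (Ordinal szy)) //= big1 ?addr0 => [|i iy].
  rewrite take_size_cat // drop_size_cat // /pos_vert /= take_size_cat //.
  by move/eqP: cyz; rewrite /qend => ->; case: (y) (z) => ? ? [? ?].
apply: off; first exact: (esym (pcat_split t (pcat y z) i)).
have il : (i <= size (y.2 ++ z.2))%N by rewrite -ltnS ltn_ord.
by rewrite /= size_takel //; apply: contraNneq iy => E; apply/eqP/val_inj.
Qed.

Lemma fmul_deltal r f y : composable r y -> valid (pcat r y) ->
  fmul (delta r) f (pcat r y) = f y.
Proof.
move=> ry vry; rewrite fmul_pcat // /delta ?eqxx ?mul1r // => y' z' _.
by case: (y' =P r) => [->|_ _]; rewrite ?eqxx ?mul0r.
Qed.

Lemma fmul_deltar r f y : composable y r -> valid (pcat y r) ->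
  fmul f (delta r) (pcat y r) = f y.
Proof.
move=> yr vyr; rewrite fmul_pcat // /delta ?eqxx ?mulr1 // => y' z' [_ E] ney //.
case: (z' =P r) => [zr|_]; rewrite ?mulr0 //.
have := congr1 size E; rewrite zr !size_cat => /addIn szE.
by rewrite szE eqxx in ney.
Qed.

Lemma fmul_deltal_neq0 r f q : fmul (delta r) f q != 0%R ->
  exists z, [/\ q = pcat r z, composable r z, valid q, f z != 0%R
             & fmul (delta r) f q = f z].
Proof.
case/fmul_neq0=> [y [z [-> yz vyz]]]; rewrite {1}/delta.
have [yr _ fz|] := eqVneq y r; last by rewrite eqxx.
by rewrite yr in yz vyz *; exists z; split; rewrite ?fmul_deltal.
Qed.

Lemma fmul_deltar_neq0 r f q : fmul f (delta r) q != 0%R ->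
  exists y, [/\ q = pcat y r, composable y r, valid q, f y != 0%R
             & fmul f (delta r) q = f y].
Proof.
case/fmul_neq0=> [y [z [-> yz vyz fy]]]; rewrite {1}/delta.
have [zr _|] := eqVneq z r; last by rewrite eqxx.
by rewrite zr in yz vyz *; exists y; split; rewrite ?fmul_deltar.
Qed.

Lemma I_kq f : I f -> kq s t f. Proof. by case: I_ideal => H _ _ _ _; apply: H. Qed.
Lemma I_valid f p : I f -> f p != 0%R -> valid p.
Proof. by move=> /I_kq[S HS] /HS /andP[]. Qed.
Lemma I_0 : I (fun _ => 0%R). Proof. by case: I_ideal => _ []. Qed.
Lemma I_add f g : I f -> I g -> I (fun p => f p + g p)%R.
Proof. by case: I_ideal => _ [_ H] _ _ _; apply: H. Qed.
Lemma I_scale c f : I f -> I (fun p => c * f p)%R.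
Proof. by case: I_ideal => _ _ H _ _; apply: H. Qed.
Lemma I_mull r f : valid r -> I f -> I (fmul (delta r) f).
Proof. by case: I_ideal => _ _ _ H _ vr If; case: (H _ _ If (kq_delta vr)). Qed.
Lemma I_mulr r f : valid r -> I f -> I (fmul f (delta r)).
Proof. by case: I_ideal => _ _ _ H _ vr If; case: (H _ _ If (kq_delta vr)). Qed.
Lemma I_eq f g : f =1 g -> I f -> I g.
Proof. by move=> /functional_extensionality ->. Qed.

Lemma TipI_valid p : TipI p -> valid p.
Proof. by case=> f [If [fp _]]; apply: I_valid fp. Qed.

(** If [f] in I has tip [p], then the product of [r] and [f] lies in I and has tip [pcat r p],
    because the order is compatible with left multiplication. *)
Lemma TipI_mull r p : valid r -> composable r p -> TipI p -> TipI (pcat r p).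
Proof.
move=> vr rp Tp; have vp := TipI_valid Tp; case: Tp => f [If [fp tip]].
exists (fmul (delta r) f); split; first exact: I_mull.
split; first by rewrite fmul_deltal // valid_pcat // vr.
move=> q /fmul_deltal_neq0[z [-> rz _ fz _]] neq.
apply: lt_mull => //; first exact: I_valid If fz.
by apply: tip => // zp; apply: neq; rewrite zp.
Qed.

Lemma TipI_mulr r p : valid r -> composable p r -> TipI p -> TipI (pcat p r).
Proof.
move=> vr rp Tp; have vp := TipI_valid Tp; case: Tp => f [If [fp tip]].
exists (fmul f (delta r)); split; first exact: I_mulr.
split; first by rewrite fmul_deltar // valid_pcat // vr andbT.
move=> q /fmul_deltar_neq0[y [-> yr _ fy _]] neq.
apply: lt_mulr => //; first exact: I_valid If fy.
by apply: tip => // yp; apply: neq; rewrite yp.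
Qed.

Lemma NonTip_pcat p q : composable p q -> NonTip (pcat p q) -> NonTip p /\ NonTip q.
Proof.
move=> pq [vpq nT]; move: vpq; rewrite valid_pcat // => /andP[vp vq].
by split; split=> // T; apply: nT; [apply: TipI_mulr|apply: TipI_mull].
Qed.

Lemma I_tip f p : I f -> f p != 0%R -> exists q, is_tip lt f q.
Proof.
move=> If fp; have [S HS] := I_kq If.
pose l := [seq q <- S | f q != 0%R].
have lP q : (q \in l) = (f q != 0%R).
  by rewrite mem_filter; case: (boolP (f q != 0%R)) => // /HS /andP[].
have [||m ml mmax] := @max_path l.
- by have := lP p; rewrite fp; case: (l).
- apply/allP => q; rewrite lP; exact: I_valid.
- by exists m; split=> [|q fq]; [rewrite -lP | apply: mmax; rewrite lP].
Qed.

(** Linear independence of [NonTip] modulo I: a nonzero [f] would have a tip, which lies both in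
    Tip(I) and in its complement. *)
Lemma I_NonTip0 f : I f -> (forall p, f p != 0%R -> NonTip p) -> forall p, f p = 0%R.
Proof.
move=> If nT p; apply: contraTeq isT => fp.
have [q [fq tip]] := I_tip If fp.
by have [_ []] := nT q fq; exists f.
Qed.

(** Rewriting modulo I is linear, so representatives of the single terms add up; [P] carries along
    whatever is known about their supports. *)
Lemma combine_nf (P : pth -> Prop) (X : lc k pth) :
  (forall c, c \in X -> exists L : lc k pth, (forall d, d \in L -> P d.2) /\
     I (fun q => delta c.2 q - coef L q)%R) ->
  exists L : lc k pth, (forall d, d \in L -> P d.2) /\
     I (fun q => coef X q - coef L q)%R.
Proof.
elim: X => [_|c X IH H].
  exists [::]; split=> //; apply: I_eq I_0 => q.
  by rewrite /coef big_nil subr0.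
have [|L [PL IL]] := IH; first by move=> d dX; apply: H; rewrite inE dX orbT.
have [|L' [PL' IL']] := H c; first by rewrite inE eqxx.
exists (lscale c.1 L' ++ L); split.
  move=> d; rewrite mem_cat => /orP[/mapP[e /PL' Pe ->]|/PL] //.
apply: I_eq (I_add (I_scale c.1 IL') IL) => q /=.
rewrite -[c :: X]cat1s !coef_cat coef_scale /delta; case: c {H IL'} => a x.
rewrite coef_single [x == q]eq_sym /= opprD mulrBr addrACA.
by case: eqP; rewrite ?mulr1 ?mulr0.
Qed.

(** Induction along the well-order: an element of I with tip [p] rewrites [p] into smaller paths,
    which already have normal forms. Cutting that element down to paths parallel to [p] preserves
    the endpoints. *)
Lemma nf_ex p : valid p -> exists L : lc k pth,
  (forall c, c \in L -> [/\ NonTip c.2, c.2.1 = p.1, qend c.2 = qend p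
                         & c.2 = p \/ lt c.2 p]) /\
  I (fun q => delta p q - coef L q)%R.
Proof.
move: p; apply: lt_ind => p vp IH.
have [[f [If [fp tip]]]|nT] := classic (TipI p); last first.
  exists [:: (1%R, p)]; split.
    by move=> c; rewrite inE => /eqP ->; split=> //; left.
  apply: I_eq I_0 => q; rewrite coef_single /delta [p == q]eq_sym.
  by case: eqP; rewrite subrr.
(* f itself may involve paths that are not parallel to its tip p. *)
pose g := fmul (delta (p.1, [::])) (fmul f (delta (qend p, [::]))).
have Ig : I g by apply/I_mull/I_mulr.
have gE q : g q != 0%R -> [/\ g q = f q, q.1 = p.1 & qend q = qend p].
  case/fmul_deltal_neq0=> z [-> /eqP pz _ hz gz]; rewrite {1}/g gz.
  case/fmul_deltar_neq0: hz pz => y [-> /eqP yp _ _ ->].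
  rewrite pcat_nil => pz; have -> : pcat (p.1, [::]) y = y.
    by move: pz; rewrite /qend /=; case: (y) => ? ? /= ->.
  by split.
have gp : g p = f p.
  have pE : pcat (p.1, [::]) (pcat p (qend p, [::])) = p.
    by rewrite pcat_nil; case: (p).
  have vpe : valid (pcat p (qend p, [::])) by rewrite pcat_nil.
  by rewrite -[in LHS]pE /g fmul_deltal ?fmul_deltar // /Defs.composable eqxx.
have [S HS] := I_kq Ig.
pose r := undup [seq q <- S | (g q != 0%R) && (q != p)].
have rP q : (q \in r) = (g q != 0%R) && (q != p).
  rewrite mem_undup mem_filter; case: (boolP (g q != 0%R)) => //= /HS /andP[_ ->].
  by rewrite andbT.
have [|L [PL IL]] := @combine_nf (fun u => 
   [/\ NonTip u, u.1 = p.1, qend u = qend p & u = p \/ lt u p])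
   [seq (g q, q) | q <- r].
  move=> c /mapP[q]; rewrite rP => /andP[gq /eqP qp] -> /=.
  have [gfq q1 qe] := gE q gq; have vq := I_valid Ig gq.
  have ltqp : lt q p by apply: tip => //; rewrite -gfq.
  have [L [PL IL]] := IH q vq ltqp; exists L; split=> // d /PL[nTd d1 de dq].
  split; rewrite ?d1 ?de //; right; case: dq => [->//|dq].
  by apply: lt_trans ltqp => //; case: nTd.
(* Modulo I, [p] equals -(g p)^-1 times the sum of the other terms of [g], and [L] represents that
   sum. *)
exists (lscale (- (g p)^-1) L); split; first by move=> c /mapP[d /PL Hd ->].
have gp0 : g p != 0%R by rewrite gp.
apply: I_eq (I_add (I_scale (g p)^-1 Ig) (I_scale (- (g p)^-1) IL)) => q /=.
rewrite coef_scale mulrBr addrA; congr (_ - _)%R; rewrite mulNr -mulrBr.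
rewrite coef_graph ?undup_uniq // rP /delta.
have [->|_] := eqVneq q p; first by rewrite andbF subr0 mulVf.
by rewrite andbT; have [->|_] := eqVneq (g q) 0%R; rewrite /= subrr mulr0.
Qed.

Lemma nf_spec X : (exists L : lc k pth, (forall c, c \in L -> NonTip c.2) /\
    I (fun q => coef X q - coef L q)%R) ->
  (forall c, c \in nf X -> NonTip c.2) /\ I (fun q => coef X q - coef (nf X) q)%R.
Proof. exact: epsilon_spec. Qed.

(** [nf] is chosen by [epsilon]; its coefficients are nevertheless determined, since the difference
    of two candidates lies in I and is supported on [NonTip]. *)
Lemma nf_unique X L : (forall c, c \in L -> NonTip c.2) ->
  I (fun q => coef X q - coef L q)%R -> coef (nf X) =1 coef L.
Proof.
move=> nTL IL; have [|nTn In] := @nf_spec X; first by exists L.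
move=> x; apply/eqP; rewrite -subr_eq0; apply/eqP; move: x.
apply: I_NonTip0 => [|x].
  apply: I_eq (I_add IL (I_scale (-1)%R In)) => x /=.
  by rewrite mulN1r opprB [(_ + (_ - _))%R]addrC -addrA addKr.
have [n0|nn _] := eqVneq (coef (nf X) x) 0%R; last first.
  by have /mapP[c /nTn ? ->] := coef_neq0 nn.
rewrite n0 sub0r oppr_eq0 => Lx.
by have /mapP[c /nTL ? ->] := coef_neq0 Lx.
Qed.

Lemma coef_nf_nil x : coef (nf [::]) x = 0%R.
Proof.
rewrite (@nf_unique _ [::]) //; first by rewrite /coef big_nil.
by apply: I_eq I_0 => q; rewrite subrr.
Qed.

Lemma nfc_NonTip p x : NonTip p -> nfc p x = (if x == p then 1 else 0)%R.
Proof.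
move=> nT; rewrite /nfc (@nf_unique _ [:: (1%R, p)]) ?coef_single 1?eq_sym //.
  by move=> c; rewrite inE => /eqP ->.
by apply: I_eq I_0 => q; rewrite subrr.
Qed.

Lemma nfc_supp p u : valid p -> nfc p u != 0%R ->
  [/\ NonTip u, u.1 = p.1, qend u = qend p & u = p \/ lt u p].
Proof.
move=> vp; have [L [PL IL]] := nf_ex vp.
rewrite /nfc (@nf_unique _ L) => [/coef_neq0/mapP[c /PL ? ->] //|c /PL[]//|].
by apply: I_eq IL => q; rewrite coef_single /delta eq_sym; case: eqP.
Qed.

Lemma nfc_tip p u : TipI p -> nfc p u != 0%R -> lt u p.
Proof.
move=> Tp; case/nfc_supp => [|[_ nTu] _ _ [up|//]]; first exact: TipI_valid.
by rewrite up in nTu.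
Qed.

(** * Chains *)

Definition tipb p : bool := if excluded_middle_informative (TipI p) then true else false.

Lemma tipP p : reflect (TipI p) (tipb p).
Proof. by rewrite /tipb; case: excluded_middle_informative => H; constructor. Qed.

Lemma NonTip_tipb p : NonTip p -> tipb p = false.
Proof. by case=> _ nT; apply/tipP. Qed.

(* An arrow u -> w of the Ufnarovskii graph, between pieces, is encoded by
   [nxt (Some u) w]: [pcat u w] lies in Tip(I), no proper left factor does.
   [None] stands for a vertex of Q, after which a chain starts with an arrow of Q. *)
Definition over o w : bool :=
  if o is Some u then tipb (pcat u w) else (0 < size w.2)%N.
Definition nxt o w : bool :=
  over o w && ~~ over o (w.1, take (size w.2).-1 w.2).

(** The conditions under which [over] is inherited by longer prefixes of [w] and fails for the empty
    prefix. *)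
Definition linkable o w : Prop :=
  if o is Some u then composable u w /\ NonTip u else True.

Lemma linkable_start o w v : w.1 = v.1 -> linkable o w -> linkable o v.
Proof. by rewrite /linkable /Defs.composable => ->. Qed.

Lemma over_pcat o w z :
  linkable o w -> composable w z -> valid z -> over o w -> over o (pcat w z).
Proof.
case: o => [u|] lk wz vz /=; last by move=> w0; rewrite size_cat ltn_addr.
move=> /tipP T; rewrite pcatA; apply/tipP/TipI_mulr => //.
by case: lk => uw _; rewrite composable_pcatl.
Qed.

Lemma over_take o w i j : linkable o w -> valid w -> (i <= j)%N ->
  over o (w.1, take i w.2) -> over o (w.1, take j w.2).
Proof.
move=> lk vw ij ov.
rewrite (pcat_split t (w.1, take j w.2) i) /= take_takel //; apply: over_pcat => //.
- have -> : take i w.2 = take i (take j w.2) by rewrite take_takel.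
  exact: (composable_split t (w.1, take j w.2)).
move: vw; rewrite (valid_split s t w j) => /andP[+ _].
by rewrite (valid_split s t _ i) => /andP[].
Qed.

Lemma over_take0 o w : linkable o w -> ~~ over o (w.1, take 0 w.2).
Proof.
by rewrite take0; case: o => [u|] //= [_ nTu]; rewrite pcat_nil NonTip_tipb.
Qed.

(** Cut after the shortest prefix that is [over]: it is nonempty, and it is proper because [x]
    itself is not minimal. *)
Lemma nxt_split o x : linkable o x -> valid x -> over o x -> ~~ nxt o x ->
  exists w w', [/\ x = pcat w w', composable w w', (0 < size w.2)%N,
                   (0 < size w'.2)%N & nxt o w].
Proof.
move=> lk vx ovx nnx.
have exj : exists j, over o (x.1, take j x.2).
  by exists (size x.2); rewrite take_size; case: (x) ovx.
case: (ex_minnP exj) => j ovj minj.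
have j0 : (0 < j)%N by case: j ovj {minj} => // /(negP (over_take0 lk)).
have jx : (j < size x.2)%N.
  have jle : (j <= size x.2)%N by apply: minj; rewrite take_size; case: (x) ovx.
  rewrite ltn_neqAle jle andbT; apply: contraNneq nnx => jE.
  rewrite /nxt ovx /=; apply/negP => /minj.
  by rewrite -jE leqNgt prednK // leqnn.
exists (x.1, take j x.2), (pos_vert t x j, drop j x.2).
have szj : size (take j x.2) = j by rewrite size_takel // ltnW.
split; rewrite /= ?szj ?size_drop ?subn_gt0 //.
- exact: pcat_split.
- exact: composable_split.
rewrite /nxt ovj /= szj take_takel ?leq_pred //.
by apply/negP => /minj; rewrite leqNgt prednK // leqnn.
Qed.

(** Dropping the last arrow of [pcat w z] still leaves a path beginning with [w], hence one that is
    [over]. *)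
Lemma nxt_proper o w z : linkable o w -> valid w -> valid z ->
  composable w z -> (0 < size z.2)%N -> nxt o w -> ~~ nxt o (pcat w z).
Proof.
move=> lk vw vz wz z0 /andP[ov _]; rewrite /nxt negb_and negbK; apply/orP; right.
apply: (@over_take _ (pcat w z) (size w.2)).
- exact: linkable_start lk.
- by rewrite valid_pcat // vw.
- by rewrite size_cat; case: (size z.2) z0 => // m _; rewrite addnS leq_addr.
- by rewrite /= take_size_cat //; case: (w) ov.
Qed.

(** Of two different minimal prefixes of one path, the shorter would be a proper prefix of the
    longer and already [over]. *)
Lemma nxt_inj o w z w' z' : linkable o w -> valid (pcat w z) ->
  composable w z -> composable w' z' -> pcat w z = pcat w' z' ->
  nxt o w -> nxt o w' -> w = w' /\ z = z'.
Proof.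
move=> lk vwz wz wz' E nw nw'; apply: (pcat_inj wz wz' E).
have E1 : w.1 = w'.1 by case: E.
have E2 : w.2 ++ z.2 = w'.2 ++ z'.2 by case: E.
have lk' : linkable o w' by apply: linkable_start lk.
have [vw vw'] : valid w /\ valid w'.
  by move: vwz (vwz); rewrite {1}E !valid_pcat // => /andP[? _] /andP[].
have aux v v' : linkable o v' -> valid v' -> v.1 = v'.1 -> nxt o v -> nxt o v' ->
    v.2 = take (size v.2) v'.2 -> (size v.2 < size v'.2)%N -> False.
  move=> lv vv v1 /andP[ov _] /andP[_ /negP nov'] vE szv; apply: nov'.
  apply: (@over_take _ v' (size v.2)) => //; last by rewrite -vE -v1; case: (v) ov.
  by case: (size v'.2) szv.
case: (ltngtP (size w.2) (size w'.2)) => // sz; exfalso.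
  apply: (aux w w') => //; move/(congr1 (take (size w.2))): E2.
  by rewrite take_size_cat // takel_cat // ltnW.
apply: (aux w' w) => //; move/(congr1 (take (size w'.2))): E2.
by rewrite [RHS]take_size_cat // takel_cat // ltnW.
Qed.

Fixpoint chain o ws : bool :=
  if ws is w :: ws' then nxt o w && chain (Some w) ws' else true.
Definition olast o ws : option pth :=
  if ws is w :: ws' then Some (last w ws') else o.
Definition stops o ws : bool := if ws is w :: _ then ~~ nxt o w else true.

Lemma olast_rcons o A x : olast o (rcons A x) = Some x.
Proof. by case: A => [|a A] //=; rewrite last_rcons. Qed.

Lemma chain_cat o A B : chain o (A ++ B) = chain o A && chain (olast o A) B.
Proof. by elim: A o => [|a A IH] o //=; rewrite IH andbA; case: A {IH}. Qed.

(* Every vertex splits uniquely as A ++ B with A its longest prefix that is a chain.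
   With x the head of B and u the last piece of A, the vertex is the target of a matched
   arrow if ux is in Tip(I), and the source of one if ux is not. *)
Lemma chain_stops o ws : exists A B,
  [/\ ws = A ++ B, chain o A & stops (olast o A) B].
Proof.
elim: ws o => [|w ws IH] o; first by exists [::], [::].
have [nw|nw] := boolP (nxt o w); last by exists [::], (w :: ws).
have [A [B [-> cA sB]]] := IH (Some w).
by exists (w :: A), B; rewrite /= nw; split=> //; case: A cA sB.
Qed.

(** Where the shorter prefix ends, [stops] denies [nxt] for the next piece, while the longer chain
    asserts it. *)
Lemma chain_stops_inj o A B A' B' : A ++ B = A' ++ B' ->
  chain o A -> stops (olast o A) B -> chain o A' -> stops (olast o A') B' ->
  A = A' /\ B = B'.
Proof.
elim: A o A' => [|a A IH] o [|a' A'] /=.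
- by move->.
- by move=> -> /= _ /negbTE ->.
- by move=> <- /= /andP[-> _].
move=> [<- E] /andP[_ cA] sB /andP[_ cA'] sB'.
have olE C : olast (Some a) C = Some (last a C) by case: C.
by have [||-> ->] := IH (Some a) A' E cA _ cA'; rewrite ?olE.
Qed.

(** * Pieces of bar vertices, and agreement of [chain] with paths in the Ufnarovskii graph *)

Definition piece w : Prop := NonTip w /\ (0 < size w.2)%N.
Definition pieces ws : Prop :=
  (forall w, w \in ws -> piece w) /\ sorted composable ws.

(** A path with a factor in Tip(I) arises from it by multiplication on both sides, and Tip(I) is
    stable under this. *)
Lemma in_tip_idealE p : in_tip_ideal p <-> TipI p.
Proof.
split=> [[vp [y [[i [j [/andP[ij jp] ->]]] Ty]]]|Tp]; last first.
  split; first exact: TipI_valid Tp.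
  exists p; split=> //; exists 0, (size p.2); split; first exact: leqnn.
  by rewrite /subp /pos_vert take0 subn0 drop0 take_size; case: (p).
have drE : drop j p.2 = drop (j - i) (drop i p.2) by rewrite drop_drop subnK.
have c1 : composable (p.1, take i p.2) (subp t p i j) by apply: composable_split.
have c2 : composable (subp t p i j) (pos_vert t p j, drop j p.2).
  rewrite /Defs.composable /Defs.qend /subp /pos_vert /= -last_cat -map_cat.
  by rewrite -takeD subnKC.
have -> : p = pcat (p.1, take i p.2)
               (pcat (subp t p i j) (pos_vert t p j, drop j p.2)).
  by rewrite /pcat /= drE !cat_take_drop; case: (p).
apply: TipI_mull => //; last apply: TipI_mulr => //.
- by move: vp; rewrite (valid_split s t p i) => /andP[].
- by move: vp; rewrite (valid_split s t p j) => /andP[].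
Qed.

Lemma in_tip_ideal_factor p w : valid p -> factor t w p -> TipI w -> TipI p.
Proof. by move=> vp fw Tw; apply/in_tip_idealE; split=> //; exists w. Qed.

Lemma subp_prefix p j : subp t p 0 j = (p.1, take j p.2).
Proof. by rewrite /subp /pos_vert take0 subn0 drop0. Qed.

(** An arrow of the second kind out of a vertex would put [v] itself in Tip(I); so [v] is an arrow
    of the quiver. *)
Lemma qw_arrow_vertex e v : piece v -> qw_arrow (e, [::]) v -> nxt None v.
Proof.
move=> [nTv _] [_ [_ [[e' [x [_ -> _]]] //|]]].
case=> _ _ /eqP /= ev /in_tip_idealE Tv _.
suff E : pcat (e, [::]) v = v by case: nTv => _ []; rewrite -E.
by move: ev; rewrite /Defs.qend /=; case: (v) => ? ? /= <-.
Qed.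

Lemma nxt_arrow v : valid v -> nxt None v ->
  exists e, qw_arrow (e, [::]) v /\ qw_vert v.
Proof.
case: v => v [|a [|b l]] //= /andP[/eqP /= <- _] _.
exists (s a); split; last by right; left; exists a.
split; first by left; exists (s a).
split; first by right; left; exists a.
by left; exists (s a), a.
Qed.

Lemma qw_arrow_nxt u v : piece u -> piece v -> qw_arrow u v -> nxt (Some u) v.
Proof.
move=> [_ u0] [_ v0] [_ [_ [[e [x [uE _ _]]]|]]]; first by rewrite uE in u0.
case=> _ _ uv /in_tip_idealE T mn; rewrite /nxt; apply/andP; split; first exact/tipP.
apply/negP => /tipP T'; apply: (mn (size u.2 + (size v.2).-1)).
  by rewrite /pcat /= size_cat ltn_add2l prednK.
rewrite subp_prefix /= take_cat ltnNge leq_addr /= addKn.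
exact/in_tip_idealE.
Qed.

(** The point is that [v] is a vertex of the graph. The path uv has a factor w in W; by minimality w
    reaches the end of uv, and it starts inside u because v is not in Tip(I). So v is a proper right
    factor of w. *)
Lemma nxt_qw_arrow u v : piece u -> piece v -> composable u v -> qw_vert u ->
  nxt (Some u) v -> qw_arrow u v.
Proof.
move=> [nTu u0] [nTv v0] uv qu /andP[/tipP T /tipP nT].
have [vu _] := nTu; have [vv _] := nTv.
have vuv : valid (pcat u v) by rewrite valid_pcat // vu.
have minuv j : (j < size (pcat u v).2)%N -> ~ TipI ((pcat u v).1, take j (pcat u v).2).
  move=> ljs Tj; apply: nT; rewrite /pcat /=.
  have -> : u.2 ++ take (size v.2).-1 v.2
          = take (size u.2 + (size v.2).-1) (u.2 ++ v.2).
    by rewrite take_cat ltnNge leq_addr /= addKn.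
  set w := (_, _).
  have lejs : (j <= size u.2 + (size v.2).-1)%N.
    by rewrite -ltnS -addnS prednK // -size_cat.
  apply: (in_tip_ideal_factor _ _ Tj); rewrite /w.
    by move: vuv; rewrite (valid_split s t _ (size u.2 + (size v.2).-1)) => /andP[].
  exists 0, j; rewrite subp_prefix /= take_takel //; split=> //.
  by rewrite size_takel // size_cat leq_add2l leq_pred.
split=> //; split; last first.
  right; split=> //; first exact/in_tip_idealE.
  by move=> j ljs; rewrite subp_prefix => /in_tip_idealE; apply: minuv.
right; right.
case: G_basis => GI _ _ Wfac _.
have /Wfac[_ [w [Ww]]] : in_tip_ideal (pcat u v) by apply/in_tip_idealE.
case=> i [j [/andP[ij jle] wE]].
have Tw : TipI w by case: Ww => g [/GI Ig tg]; exists g.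
exists w; split=> //.
(* If w ended earlier, a proper left factor of uv would lie in Tip(I). *)
have jE : j = size (pcat u v).2.
  apply/eqP; rewrite eqn_leq jle leqNgt; apply/negP => /minuv; apply.
  apply: in_tip_ideal_factor Tw.
    by move: vuv; rewrite (valid_split s t _ j) => /andP[].
  exists i, j; rewrite /= size_takel // ij leqnn; split=> //.
  rewrite wE /subp /pos_vert /=; congr (_, _).
    by rewrite take_takel.
  by rewrite take_drop subnK // [RHS]take_drop subnK // take_takel.
have ends : last u.1 (map t u.2) = v.1 by apply/eqP.
(* If w started after u, it would be a factor of v. *)
have iu : (i < size u.2)%N.
  rewrite ltnNge; apply/negP => ui; case: nTv => _ []; apply: in_tip_ideal_factor Tw => //.
  exists (i - size u.2), (size v.2); split.
    by rewrite leqnn andbT leq_subLR -size_cat (leq_trans ij).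
  rewrite wE jE /subp /pos_vert /= size_cat take_cat drop_cat ltnNge ui /=.
  rewrite map_cat last_cat ends.
  by congr (_, take _ _); rewrite subnBA // addnC.
have {}wE : w = (pos_vert t u i, drop i u.2 ++ v.2).
  by rewrite wE jE /subp -size_drop take_size /pos_vert /= take_cat drop_cat iu.
have szw : size (drop i u.2) = size u.2 - i by rewrite size_drop.
split; last first.
  move=> vw; have := congr1 (fun x => size x.2) vw; rewrite wE /= size_cat szw.
  move/eqP; rewrite -[X in X == _]add0n eqn_add2r eq_sym subn_eq0.
  by rewrite leqNgt iu.
exists (size u.2 - i); rewrite wE /= size_cat szw leq_addr; split=> //.
rewrite /subp /pos_vert /= take_size_cat // drop_size_cat // addKn take_size.
rewrite -last_cat -map_cat cat_take_drop ends; by case: (v).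
Qed.

Lemma qchainP x ws : piece x -> qw_vert x -> pieces (x :: ws) ->
  qchain s t lt I G x ws <-> chain (Some x) ws.
Proof.
elim: ws x => [//|y ws IH] x px qx [pxy /= /andP[xy yws]].
have py : piece y by apply: pxy; rewrite !inE eqxx orbT.
have pyws : pieces (y :: ws).
  by split=> // w wy; apply: pxy; rewrite inE wy orbT.
split=> [[axy cy]|/andP[nxy cy]].
  rewrite qw_arrow_nxt //=; apply/IH => //; by case: axy => _ [].
have axy : qw_arrow x y by apply: nxt_qw_arrow.
by split=> //; apply/IH => //; case: axy => _ [].
Qed.

Lemma is_chainP ws : pieces ws -> ws != [::] ->
  is_chain (size ws).-1 ws <-> chain None ws.
Proof.
case: ws => [//|x ws] pxw _.
have px : piece x by apply: (proj1 pxw); rewrite inE eqxx.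
split=> [[_ _ [e [ax cx]]]|/andP[nx cx]].
  have nx : nxt None x by apply: qw_arrow_vertex ax.
  by rewrite /= [X in X && _]nx; apply/qchainP => //; case: ax => _ [].
have [e [ax qx]] := nxt_arrow (proj1 (proj1 px)) nx.
split=> //; last by exists e; split=> //; apply/qchainP.
by move=> v /(proj1 pxw) [[]].
Qed.

Lemma sorted_catl A B : sorted composable (A ++ B) -> sorted composable A.
Proof. by case: A => [|a A] //=; rewrite cat_path => /andP[]. Qed.

Lemma sorted_catr A B : sorted composable (A ++ B) -> sorted composable B.
Proof.
by elim: A => [//|a A IH] /= /path_sorted /IH.
Qed.

Lemma pieces_catl A B : pieces (A ++ B) -> pieces A.
Proof.
by case=> pAB /sorted_catl; split=> // w wA; apply: pAB; rewrite mem_cat wA.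
Qed.

(** Prefixes of chains are chains, so maximality of the length amounts to failure of the very next
    extension. *)
Lemma chain_lenP ws m : pieces ws ->
  chain_len s t lt I G ws m <->
  exists A B, [/\ ws = A ++ B, size A = m, chain None A & stops (olast None A) B].
Proof.
move=> pws.
have chainT n : (n <= size ws)%N -> n != 0%N ->
    is_chain n.-1 (take n ws) <-> chain None (take n ws).
  move=> nle n0; have szn : size (take n ws) = n by rewrite size_takel.
  rewrite -[in n.-1]szn; apply: is_chainP; last by rewrite -size_eq0 szn.
  by apply: (@pieces_catl _ (drop n ws)); rewrite cat_take_drop.
split=> [[mle cm maxm]|[A [B [E szA cA sB]]]].
  exists (take m ws), (drop m ws); rewrite cat_take_drop size_takel //; split=> //.
    have [->|m0] := eqVneq m 0%N; first by rewrite take0.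
    by apply/chainT => //; case: cm m0 => [->|].
  case E: (drop m ws) => [//|x B] /=; apply/negP => nx.
  have mlt : (m < size ws)%N.
    by rewrite ltnNge; apply/negP => wsm; rewrite drop_oversize in E.
  apply: (maxm m.+1); rewrite ?ltnSn //; apply/chainT => //.
  rewrite -addn1 takeD chain_cat E /= take0 /= nx !andbT.
  have [->|m0] := eqVneq m 0%N; first by rewrite take0.
  by apply/chainT => //; case: cm m0 => [->|].
rewrite -szA E; split; first by rewrite size_cat leq_addr.
  rewrite take_size_cat //; have [A0|A0] := eqVneq A [::]; first by left; rewrite A0.
  by right; apply/is_chainP => //; apply: (@pieces_catl _ B); rewrite -E.
move=> m' /andP[Am' m'le].
have m'0 : m' != 0%N by case: (m') Am'.
rewrite -E in m'le *; move/chainT => /(_ m'le m'0).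
rewrite E take_cat ltnNge (ltnW Am') /= chain_cat => /andP[_].
case: B E sB => [|x B] E.
  by rewrite E cats0 leqNgt Am' in m'le.
by move=> /= /negbTE nx; rewrite -subn_gt0 in Am'; case: (m' - _) Am' => //= l _; rewrite nx.
Qed.

Lemma path_qend x y B : qend x = qend y -> path composable x B = path composable y B.
Proof. by move=> xy; case: B => [|b B] //=; rewrite /Defs.composable xy. Qed.

(** The neighbours see only the outer endpoints; this serves splitting, merging and reduction to
    normal form. *)
Lemma sorted_splice A x y u B : composable x y -> u.1 = x.1 -> qend u = qend y ->
  sorted composable (A ++ u :: B) = sorted composable (A ++ x :: y :: B).
Proof.
move=> xy ux uy; case: A => [|a A] /=; first by rewrite xy (path_qend _ uy).
rewrite !cat_path /= xy (path_qend _ uy).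
by congr (_ && (_ && _)); rewrite /Defs.composable ux.
Qed.

Lemma piecesP ws : qb_vert (inr ws) <-> ws != [::] /\ pieces ws.
Proof. by split=> [[? ? ?]|[? []]]. Qed.

Lemma pieces_mid A x B : pieces (A ++ x :: B) ->
  [/\ pieces A, piece x, pieces B & linkable (olast None A) x].
Proof.
move=> pAB; have pA := pieces_catl pAB; case: pAB => pAB sAB.
have pin y : y \in x :: B -> piece y by move=> yB; apply: pAB; rewrite mem_cat yB orbT.
split=> //.
- by apply: pin; rewrite inE eqxx.
- split; first by move=> y yB; apply: pin; rewrite inE yB orbT.
  by move/sorted_catr: sAB => /path_sorted.
- case: A pAB sAB pA {pin} => [//|a A] pAB; rewrite /= cat_path => /andP[_ /= /andP[ax _]] _.
  by split=> //; case: (pAB (last a A)) => //; rewrite /= -cat_cons mem_cat mem_last.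
Qed.

Lemma pieces_split A w z B : composable w z -> (0 < size w.2)%N -> (0 < size z.2)%N ->
  pieces (A ++ pcat w z :: B) -> pieces (A ++ w :: z :: B).
Proof.
move=> wz w0 z0 [pAB sAB]; split; last first.
  by rewrite -(@sorted_splice _ _ _ (pcat w z)) ?qend_pcat.
have [nTwz _] : piece (pcat w z) by apply: pAB; rewrite mem_cat inE eqxx orbT.
have [nTw nTz] := NonTip_pcat wz nTwz.
move=> y; rewrite mem_cat !inE => /or4P[yA|/eqP ->|/eqP ->|yB] //.
  by apply: pAB; rewrite mem_cat yA.
by apply: pAB; rewrite mem_cat inE yB !orbT.
Qed.

(** * The matching *)

(* [w] and [z] play the roles of w'_{i+2} and w''_{i+2} in the definition of M *)
Definition matched A w z B : qbarr V Ar :=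
  (A ++ w :: z :: B, (size A).+1, inr (A ++ pcat w z :: B)).

Definition matchable A w z B : Prop :=
  [/\ pieces (A ++ pcat w z :: B), composable w z, (0 < size w.2)%N /\ (0 < size z.2)%N,
      chain None A & nxt (olast None A) w].

Lemma matchable_src A w z B : matchable A w z B ->
  [/\ pieces (A ++ w :: z :: B), chain None (rcons A w) & ~~ over (Some w) z].
Proof.
move=> [pAB wz [w0 z0] cA nw]; split; first exact: pieces_split.
  by rewrite -cats1 chain_cat cA /= nw.
by have [_ [nT _] _ _] := pieces_mid pAB; rewrite /= NonTip_tipb.
Qed.

Lemma matchable_tgt A w z B : matchable A w z B ->
  over (olast None A) (pcat w z) && ~~ nxt (olast None A) (pcat w z).
Proof.
move=> [pAB wz [w0 z0] cA nw].
have [_ [[vwz _] _] _ lk] := pieces_mid pAB.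
have lkw : linkable (olast None A) w by apply: linkable_start lk.
move: vwz; rewrite valid_pcat // => /andP[vw vz].
by rewrite nxt_proper // andbT over_pcat //; case/andP: nw.
Qed.

Lemma nxtN_over o w : ~~ over o w -> ~~ nxt o w.
Proof. by rewrite /nxt => /negbTE ->. Qed.

(** An explicit parametrization of the matching: both conditions on longest chain prefixes reduce to
    [A] being a chain that [w] extends, since wz is outside Tip(I). *)
Lemma matchingP a : matchingM s t lt I G a <->
  exists A w z B, a = matched A w z B /\ matchable A w z B.
Proof.
split=> [[qa [ws [m [w [z [[atg qws clm mlt] [wzE w0 z0 wz] [aE cla ai]]]]]]]|].
  move/piecesP: qws => [ws0 pws].
  have [A [B [wsE szA cA sB]]] := (iffLR (chain_lenP _ pws)) clm.
  case: B wsE sB => [|x B] wsE sB.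
    by rewrite wsE cats0 szA ltnn in mlt.
  have xE : x = pcat w z by rewrite -wzE wsE nth_cat szA ltnn subnn.
  have aE' : a.1.1 = A ++ w :: z :: B.
    rewrite aE wsE -szA take_size_cat //.
    by rewrite drop_cat ltnNge leqnSn /= subSnn /= drop0.
  exists A, w, z, B; split.
    by case: a atg aE' ai {qa aE cla} => [[src i] tg] /= -> -> ->; rewrite /matched szA wsE xE.
  rewrite wsE xE in pws; split=> //.
  rewrite aE' in cla.
  have [A' [B' [E szA' cA' _]]] := (iffLR (chain_lenP _ (pieces_split wz w0 z0 pws))) cla.
  move/eqP: E; rewrite -cat_rcons eqseq_cat ?size_rcons ?szA' ?szA // => /andP[/eqP A'E _].
  by rewrite -A'E -cats1 chain_cat /= andbT in cA'; case/andP: cA'.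
case=> A [w [z [B [-> mAB]]]].
have [pAB wz [w0 z0] cA nw] := mAB.
have [psrc cAw novz] := matchable_src mAB.
have /andP[_ nnx] := matchable_tgt mAB.
have [_ [nTx _] _ _] := pieces_mid pAB.
split.
  split; first by apply/piecesP; split=> //; case: (A).
  have nthE (d : pth) : nth d (A ++ w :: z :: B) (size A) = w
                   /\ nth d (A ++ w :: z :: B) (size A).+1 = z.
    by rewrite !nth_cat ltnn subnn ltnNge leqnSn subSnn.
  have exu (d : pth) : exists u,
    nfc (pcat (nth d (A ++ w :: z :: B) (size A)) (nth d (A ++ w :: z :: B) (size A).+1)) u != 0%R /\
    (inr (A ++ pcat w z :: B) : qbv V Ar) =
      inr (take (size A) (A ++ w :: z :: B) ++ u :: drop (size A).+2 (A ++ w :: z :: B)).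
    have [-> ->] := nthE d; exists (pcat w z); rewrite nfc_NonTip // eqxx oner_neq0.
    rewrite take_size_cat // drop_cat ltnNge -addn2 leq_addr /= addKn /=.
    by rewrite drop0.
  have sz : ((size A).+1 < size (A ++ w :: z :: B))%N.
    by rewrite size_cat /= !addnS !ltnS leq_addr.
  by case: (A ++ w :: z :: B) exu sz => [//|d l] exu sz; right; right; split=> //; apply: exu.
exists (A ++ pcat w z :: B), (size A), w, z; split; split=> //.
- by apply/piecesP; split=> //; case: (A).
- by apply/chain_lenP => //; exists A, (pcat w z :: B).
- by rewrite size_cat /= addnS ltnS leq_addr.
- by rewrite nth_cat ltnn subnn.
- by rewrite /= take_size_cat // drop_cat ltnNge leqnSn /= subSnn /= drop0.
apply/chain_lenP => //; exists (rcons A w), (z :: B).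
by rewrite cat_rcons size_rcons olast_rcons; split=> //; apply: nxtN_over.
Qed.

(** The longest chain prefix of the source is [rcons A w], and it is unique. *)
Lemma matched_src_inj A w z B A' w' z' B' :
  matchable A w z B -> matchable A' w' z' B' ->
  A ++ w :: z :: B = A' ++ w' :: z' :: B' -> [/\ A = A', w = w', z = z' & B = B'].
Proof.
move=> m1 m2; have [_ c1 n1] := matchable_src m1; have [_ c2 n2] := matchable_src m2.
rewrite -(cat_rcons w) -(cat_rcons w') => /chain_stops_inj E.
have [||/rcons_inj [-> ->] [-> ->]] // := E None c1 _ c2 _;
  by rewrite olast_rcons; apply: nxtN_over.
Qed.

(** The longest chain prefix of the target is [A]; the cut of the next piece is then unique by
    [nxt_inj]. *)
Lemma matched_tgt_inj A w z B A' w' z' B' :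
  matchable A w z B -> matchable A' w' z' B' ->
  A ++ pcat w z :: B = A' ++ pcat w' z' :: B' ->
  [/\ A = A', w = w', z = z' & B = B'].
Proof.
move=> m1 m2; have /andP[_ n1] := matchable_tgt m1; have /andP[_ n2] := matchable_tgt m2.
have [p1 wz _ c1 nw] := m1; have [_ wz' _ c2 nw'] := m2.
move=> /chain_stops_inj E; have [AA' [E1 E2 BB']] := E None c1 n1 c2 n2.
have [_ [[vx _] _] _ lk] := pieces_mid p1.
have wzE : pcat w z = pcat w' z' by rewrite /pcat E1 E2.
have lkw : linkable (olast None A) w by apply: linkable_start lk.
by subst A'; have [-> ->] := nxt_inj lkw vx wz wz' wzE nw nw'.
Qed.

(** The piece after the longest chain prefix is [over] at a target and not [over] at a source. *)
Lemma matched_src_tgt A w z B A' w' z' B' :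
  matchable A w z B -> matchable A' w' z' B' ->
  A ++ w :: z :: B <> A' ++ pcat w' z' :: B'.
Proof.
move=> m1 m2; have [_ c1 n1] := matchable_src m1.
have /andP[ov n2] := matchable_tgt m2; have [_ _ _ c2 _] := m2.
rewrite -(cat_rcons w) => /chain_stops_inj E.
have [|AA' zE] := E None c1 _ c2 n2.
  by rewrite olast_rcons; apply: nxtN_over.
have [zw _] : z = pcat w' z' /\ B = B' by case: z B zE {m1 c1 n1 E} => ? ? ? [-> -> ->].
by rewrite -AA' olast_rcons -zw (negbTE n1) in ov.
Qed.

Lemma criticalP ws : pieces ws -> ws != [::] ->
  (forall a, matchingM s t lt I G a -> asrc a <> inr ws /\ atgt a <> inr ws)
  <-> chain None ws.
Proof.
move=> pws ws0; split=> [crit|cws a /matchingP[A [w [z [B [-> m]]]]]]; last first.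
  rewrite /asrc /atgt /=; split=> -[E]; rewrite -E in cws.
    have [_ _ /nxtN_over /negbTE n] := matchable_src m.
    by move: cws; rewrite -cat_rcons chain_cat olast_rcons /= n andbF.
  have /andP[_ /negbTE n] := matchable_tgt m.
  by move: cws; rewrite chain_cat /= n andbF.
have [A [[|x B] [E cA sB]]] := chain_stops None ws; first by rewrite E cats0.
rewrite E in pws *; have [_ [[vx nTx] x0] _ lk] := pieces_mid pws.
have [ov|nov] := boolP (over (olast None A) x).
  have [w [z [xE wz w0 z0 nw]]] := nxt_split lk vx ov sB.
  case: (crit (matched A w z B)); first by apply/matchingP; exists A, w, z, B; rewrite xE in pws.
  by rewrite /atgt /= -xE E.
(* After an empty chain every piece is [over]; hence [A] has a last piece, which merges with [x]
   outside Tip(I). *)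
case/lastP: A E cA sB lk nov pws => [|A w] E cA sB lk nov pws; first by rewrite /= x0 in nov.
rewrite olast_rcons in lk nov; case: lk => wx [vw nTw].
rewrite cat_rcons in E pws.
case: pws => pws sws.
have [_ w0] : piece w by apply: pws; rewrite mem_cat inE eqxx orbT.
have mAB : matchable A w x B.
  have [cA' nw] : chain None A /\ nxt (olast None A) w.
    by move: cA; rewrite -cats1 chain_cat /= andbT => /andP[].
  split=> //; split; last by rewrite (@sorted_splice _ w x) ?qend_pcat.
  move=> y; rewrite mem_cat inE => /or3P[yA|/eqP ->|yB].
  - by apply: pws; rewrite mem_cat yA.
  - split; last by rewrite size_cat ltn_addr.
    by split; [rewrite valid_pcat // vw | apply/tipP].
  - by apply: pws; rewrite mem_cat !inE yB !orbT.
case: (crit (matched A w x B)); first by apply/matchingP; exists A, w, x, B.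
by rewrite /asrc /= E.
Qed.

(** * Values of zigzags *)

Local Notation M := (matchingM s t lt I G).
Local Notation Amul := (Amul s t lt I).
Local Notation act := (act s t lt I).
Local Notation weight_of := (weight_of s t lt I).
Local Notation dot_act := (dot_act s t lt I).
Local Notation zz_val := (zz_val s t lt I).
Local Notation summ := (summ s t lt I).
Local Notation qb_arrow := (qb_arrow s t lt I).
Local Notation bimod := (lc k (pth * pth)).
Implicit Types (X Y : bimod) (W : @wt k V Ar) (zg : seq (qbarr V Ar * qbarr V Ar)).

(** Linearity of the action, tested against an arbitrary function [h] on basis elements. *)
Lemma act_sum W X (h : pth * pth -> k) :
  (\sum_(y <- act W X) y.1 * h y.2 =
   \sum_(x <- X) x.1 * \sum_(y <- act W [:: (1, x.2)]) y.1 * h y.2)%R.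
Proof.
rewrite /Defs.act big_flatten big_map; apply: eq_bigr => x _.
rewrite /= cats0 !big_allpairs_dep /= big_distrr; apply: eq_bigr => y _ /=.
rewrite big_distrr; apply: eq_bigr => z _ /=.
by rewrite mulr1 !mulrA [(wc W * x.1)%R]mulrC.
Qed.

Lemma coef_act W X c : coef (act W X) c =
  (\sum_(x <- X) x.1 * coef (act W [:: (1, x.2)]) c)%R.
Proof.
rewrite coefE (act_sum _ _ (fun d => (d == c)%:R%R)).
by apply: eq_bigr => x _; rewrite coefE.
Qed.

Lemma coef_act1 W p q p' q' : coef (act W [:: (1, (p, q))]%R) (p', q') =
  (wc W * coef (Amul [:: (1, p)] (wl W)) p' * coef (Amul (wr W) [:: (1, q)]) q')%R.
Proof.
rewrite /Defs.act /= cats0 !coefE big_allpairs_dep /= -mulrA mulr_suml mulr_sumr.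
apply: eq_bigr => y _; rewrite !mulr_sumr; apply: eq_bigr => z _ /=.
by rewrite -pair_eqE /= mulr1 -mulnb natrM !mulrA; congr (_ * _)%R; rewrite mulrAC.
Qed.

Lemma eq_coef_act W X Y : coef X =1 coef Y -> coef (act W X) =1 coef (act W Y).
Proof.
move=> eXY c; rewrite coef_act [RHS]coef_act.
exact: (@eq_sum_lc _ _ _ _ (fun d => coef (act W [:: (1, d)]) c)%R _ eXY (fun _ _ => erefl)).
Qed.

Lemma Amul_oneA_r p : Amul [:: (1%R, p)] (@oneA k V Ar) = nf [:: (1%R, p)].
Proof.
rewrite /Defs.Amul /lmul /= cats0 /oneA filter_map.
rewrite (@eq_filter _ _ (pred1 (qend p))); last by move=> v; rewrite /= eq_sym.
rewrite filter_pred1_uniq ?enum_uniq ?mem_enum //= mulr1.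
by rewrite pcat_nil.
Qed.

Lemma Amul_oneA_l q : Amul (@oneA k V Ar) [:: (1%R, q)] = nf [:: (1%R, q)].
Proof.
have aux (l : seq V) : lmul t [seq (1%R : k, (e, [::] : seq Ar)) | e : V <- l] [:: (1%R, q)]
    = [seq (1%R : k, (e, q.2)) | e : V <- [seq e : V <- l | e == q.1]].
  elim: l => [//|e l IH].
  transitivity ([seq ((1 * d.1)%R, pcat (e, [::]) d.2) | d : k * pth <-
      [seq d : k * pth <- [:: (1%R, q)] | composable (e, [::]) d.2]] ++
    lmul t [seq (1%R : k, (e, [::] : seq Ar)) | e : V <- l] [:: (1%R, q)]) => //.
  by rewrite IH /Defs.composable /Defs.qend /=; case: eqP => //= _; rewrite mulr1.
rewrite /Defs.Amul aux.
by rewrite (@filter_pred1_uniq _ _ q.1) ?enum_uniq ?mem_enum //=; case: (q).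
Qed.

Lemma Amul_single p w : Amul [:: (1%R, p)] [:: (1%R, w)] =
  nf (if composable p w then [:: (1%R, pcat p w)] else [::]).
Proof.
by rewrite /Defs.Amul /lmul /=; case: ifP => //= _; rewrite mulr1.
Qed.

(* Each dotted arrow of M acts by a nonzero scalar, so the value of a zigzag
   can be computed without inverting anything. *)
Definition lin zg X : bimod :=
  foldl (fun Y mr => act (weight_of mr.2)
                       (lscale (- (wc (weight_of mr.1))^-1)%R Y)) X zg.

Lemma coef_lin zg X c :
  coef (lin zg X) c = (\sum_(x <- X) x.1 * coef (lin zg [:: (1, x.2)]) c)%R.
Proof.
elim: zg X => [|mr zg IH] X.
  by rewrite coefE; apply: eq_bigr => x _; rewrite coef_single; case: eqP.
rewrite /lin /= -/(lin zg _) IH.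
rewrite (act_sum _ _ (fun d => coef (lin zg [:: (1%R, d)]) c)) big_map /=.
apply: eq_bigr => x _; rewrite [in RHS]IH.
rewrite (act_sum _ [:: _] (fun d => coef (lin zg [:: (1%R, d)]) c)) big_seq1 /=.
by rewrite mulr1 mulrCA mulrA.
Qed.

Lemma eq_coef_lin zg X Y : coef X =1 coef Y -> coef (lin zg X) =1 coef (lin zg Y).
Proof.
move=> eXY c; rewrite coef_lin [RHS]coef_lin.
exact: (@eq_sum_lc _ _ _ _ (fun d => coef (lin zg [:: (1, d)]) c)%R _ eXY (fun _ _ => erefl)).
Qed.

Lemma coef_act_neq0 W X c : coef (act W X) c != 0%R ->
  exists d, coef X d != 0%R /\ coef (act W [:: (1%R, d)]) c != 0%R.
Proof.
rewrite coef_act; exact: (@sum_lc_neq0 _ _ _ (fun d => coef (act W [:: (1, d)]) c)%R).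
Qed.

Lemma coef_lin_neq0 zg X c : coef (lin zg X) c != 0%R ->
  exists d, coef X d != 0%R /\ coef (lin zg [:: (1%R, d)]) c != 0%R.
Proof.
rewrite coef_lin; exact: (@sum_lc_neq0 _ _ _ (fun d => coef (lin zg [:: (1, d)]) c)%R).
Qed.

(** Since wz is its own normal form, its coefficient is 1 and the weight is a sign. *)
Lemma weight_matched A w z B : matchable A w z B ->
  exists2 a : k, a != 0%R & weight_of (matched A w z B) = Wt a (@oneA k V Ar) (@oneA k V Ar).
Proof.
move=> m; have [_ [nTx _] _ _] := pieces_mid (let: And5 h _ _ _ _ := m in h).
exists ((-1) ^+ (size A).+1)%R; first by rewrite signr_eq0.
have sz : ((size A).+1 == size (A ++ w :: z :: B)) = false.
  by rewrite size_cat /= !addnS eqSS ltn_eqF // ltnS leq_addr.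
have nthE (d : pth) : pcat (nth d (A ++ w :: z :: B) (size A))
    (nth d (A ++ w :: z :: B) (size A).+1) = pcat w z.
  by rewrite !nth_cat ltnn subnn ltnNge leqnSn subSnn.
have nthx (d : pth) : nth d (A ++ pcat w z :: B) (size A) = pcat w z.
  by rewrite nth_cat ltnn subnn.
have ne : A ++ w :: z :: B != [::] by case: (A).
rewrite /matched /Defs.weight_of; case: (A ++ w :: z :: B) ne sz nthE => [//|d l] _ sz nthE.
by rewrite sz [_.+1.-1]/= nthE nthx nfc_NonTip // eqxx mulr1.
Qed.

Definition NonTip_supported X : Prop :=
  forall c, coef X c != 0%R -> NonTip c.1 /\ NonTip c.2.

Lemma summ_NonTip (v : qbv V Ar) X : summ v X -> NonTip_supported X.
Proof. by move=> sX [p q] /sX[]. Qed.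

Lemma act_matched A w z B X c : matchable A w z B -> NonTip_supported X ->
  coef (act (weight_of (matched A w z B)) X) c
  = (wc (weight_of (matched A w z B)) * coef X c)%R.
Proof.
move=> /weight_matched[a _ ->] nX; rewrite coef_act [in RHS]coefE big_distrr /=.
transitivity (\sum_(x <- X) x.1 * (a * (x.2 == c)%:R))%R; last first.
  by apply: eq_bigr => x _; rewrite mulrCA.
apply: (eq_sum_lc (f := fun d => coef (act _ [:: (1%R, d)]) c)
                  (g := fun d => (a * (d == c)%:R)%R)) => // d /nX[n1 n2].
case: d c n1 n2 => [p q] [p' q'] /= n1 n2.
rewrite coef_act1 /= Amul_oneA_r Amul_oneA_l -!/(nfc _ _) !nfc_NonTip //.
rewrite xpair_eqE [p == p']eq_sym [q == q']eq_sym.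
by case: (p' == p); case: (q' == q); rewrite ?mulr1 ?mulr0 ?mul0r.
Qed.

(** Both sequences have the same start and end, so source and target index the same bimodule. *)
Lemma summ_matched A w z B X : composable w z ->
  summ (inr (A ++ w :: z :: B)) X <-> summ (inr (A ++ pcat w z :: B)) X.
Proof.
move=> wz; have lastE : qend (last (pcat w z) B) = qend (last z B).
  by case: B => [|b B] //=; rewrite qend_pcat.
rewrite /Defs.summ; split=> sX p q /sX[n1 n2]; case: A {sX} => [|a A] /=;
  by rewrite ?last_cat /= ?lastE.
Qed.

Lemma matched_invertible A w z B : matchable A w z B ->
  invertible_arrow s t lt I (matched A w z B).
Proof.
move=> m; have [_ wz _ _ _] := m; have [a a0 wE] := weight_matched m.
have actE X c : NonTip_supported X -> coef (act (weight_of (matched A w z B)) X) c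
    = (a * coef X c)%R by move=> nX; rewrite act_matched // wE.
rewrite /invertible_arrow /asrc /atgt /=; split.
- move=> X sX; apply/summ_matched => // p q.
  rewrite actE; last exact: summ_NonTip sX.
  by rewrite mulf_eq0 negb_or => /andP[_ /sX].
- move=> X Y sX sY E c; apply: (mulfI a0).
  by rewrite -!actE; [apply: E | apply: summ_NonTip sY | apply: summ_NonTip sX].
- move=> Y /summ_matched sY; have {}sY := sY wz; exists (lscale a^-1 Y)%R.
  have sY' : summ (inr (A ++ [:: w, z & B])) (lscale a^-1 Y)%R.
    by move=> p q; rewrite coef_scale mulf_eq0 negb_or => /andP[_ /sY].
  split=> // c; rewrite actE; last exact: summ_NonTip sY'.
  by rewrite coef_scale mulVKf.
Qed.

(** Any preimage that [epsilon] may choose has the coefficients of Y divided by the scalar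
    weight. *)
Lemma coef_dot_act A w z B Y : matchable A w z B ->
  summ (inr (A ++ pcat w z :: B)) Y ->
  coef (dot_act (matched A w z B) Y)
    =1 coef (lscale (- (wc (weight_of (matched A w z B)))^-1)%R Y).
Proof.
move=> m sY c; have [_ _ /(_ Y sY)/epsilon_spec H] := matched_invertible m.
rewrite /Defs.dot_act coef_scale [RHS]coef_scale -{}(proj2 (H (inhabits [::]))).
rewrite act_matched //; last by case: (H (inhabits [::])) => /summ_NonTip.
have [a a0 ->] := weight_matched m.
by rewrite mulN1r mulNr mulKf.
Qed.

(** * Finiteness of zigzags *)

Lemma total_lt u v D : valid u -> valid v -> qend u = qend v ->
  path composable v D -> all valid D -> lt u v -> lt (total u D) (total v D).
Proof.
move=> vu vv uv; case: D => [|d D]; first by rewrite /total !cats0 -!surjective_pairing.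
move=> /andP[vd dD] vD ltuv; rewrite !total_cons.
apply: lt_mulr => //; first exact: valid_total vD.
by rewrite /Defs.composable uv.
Qed.

(* [d] is only a default for [ws] empty. *)
Definition total0 ws : pth -> pth := fun d => total (head d ws) (behead ws).

(** [u] is parallel to xy and smaller, so multiplying by [D] on the right and then by [C] on the
    left preserves the inequality. *)
Lemma total_splice_lt C x y u D d : sorted composable (C ++ x :: y :: D) ->
  all valid (C ++ x :: y :: D) -> valid u -> u.1 = x.1 -> qend u = qend y ->
  lt u (pcat x y) -> lt (total0 (C ++ u :: D) d) (total0 (C ++ x :: y :: D) d).
Proof.
move=> sC vC vu ux uy ltu.
have /andP[xy yD] : path composable x (y :: D) by apply: (sorted_catr sC).
have xyE E : total x (y :: E) = total (pcat x y) E by rewrite /total /pcat /= catA.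
move: vC; rewrite all_cat => /and4P[vC vx vy vD].
have vxy : valid (pcat x y) by rewrite valid_pcat // vx.
have ltD : lt (total u D) (total x (y :: D)).
  rewrite xyE; apply: total_lt => //; first by rewrite qend_pcat.
  by rewrite (@path_qend _ y) // qend_pcat.
case: C sC vC => [//|c C] /= sC vC; rewrite /total0 /= !total_cat.
have : path composable c (rcons C x).
  by move: sC; rewrite -cat_rcons cat_path => /andP[].
rewrite rcons_path => /andP[cC Cx].
have CuD : composable (total c C) (total u D).
  have -> // : composable (total c C) (total u D) = composable (last c C) x.
  by rewrite /Defs.composable qend_total // -ux.
have CxD : composable (total c C) (total x (y :: D)).
  have -> // : composable (total c C) (total x (y :: D)) = composable (last c C) x.
  by rewrite /Defs.composable qend_total.
apply: lt_mull => //; apply: (@valid_total _ _ s t).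
- by rewrite (path_qend _ uy).
- by rewrite /= vu.
- by rewrite /= xy.
- by rewrite /= vx vy.
- by [].
- by [].
Qed.

Lemma total_splice C x y D d :
  total0 (C ++ pcat x y :: D) d = total0 (C ++ x :: y :: D) d.
Proof.
by case: C => [|c C]; rewrite /total0 /total /pcat ?map_cat ?flatten_cat /= !catA.
Qed.

(* The tensor of p and q is a basis element of the summand A^e.[ws]. *)
Definition good p ws q : Prop :=
  sorted composable (p :: rcons ws q) /\
  forall x, x \in p :: rcons ws q -> NonTip x.

Lemma good_total_valid p ws q : good p ws q -> valid (total p (rcons ws q)).
Proof.
by case=> sg ng; apply: valid_total => //; apply/allP => x /ng [].
Qed.

Lemma good_summ ws X : (forall p q, coef X (p, q) != 0%R -> good p ws q) ->
  ws != [::] -> summ (inr ws) X.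
Proof.
case: ws => [//|w ws] gX _ p q /gX[/= /andP[pw]]; rewrite rcons_path => /andP[_ wq].
move=> ng; split.
- by apply: ng; rewrite inE eqxx.
- by apply: ng; rewrite !inE mem_rcons inE eqxx !orbT.
- by split; [apply/eqP | apply/esym/eqP].
Qed.

Lemma summ_good p ws q X : pieces ws -> summ (inr ws) X -> coef X (p, q) != 0%R ->
  good p ws q.
Proof.
case: ws => [|w ws] [pws sws] sX /sX [np nq] // [pw wq].
split; first by rewrite /= rcons_path; apply/and3P; split=> //; apply/eqP.
move=> x; rewrite inE mem_rcons inE => /or3P[/eqP ->|/eqP ->|/pws []] //.
Qed.

(** A product in Tip(I) reduces to smaller paths, so the total drops; any other product is its own
    normal form and leaves the total unchanged. *)
Lemma good_splice p ws q p' ws' q' C x y u D :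
  good p ws q -> p :: rcons ws q = C ++ x :: y :: D ->
  p' :: rcons ws' q' = C ++ u :: D -> nfc (pcat x y) u != 0%R ->
  good p' ws' q' /\
  (lt (total p' (rcons ws' q')) (total p (rcons ws q)) \/
   [/\ total p' (rcons ws' q') = total p (rcons ws q), u = pcat x y & NonTip u]).
Proof.
move=> [sg ng] E E' nu; rewrite E in sg ng.
have /andP[xy _] : path composable x (y :: D) by apply: (sorted_catr sg).
have nx : NonTip x by apply: ng; rewrite mem_cat inE eqxx orbT.
have ny : NonTip y by apply: ng; rewrite mem_cat !inE eqxx !orbT.
have vxy : valid (pcat x y) by rewrite valid_pcat //; apply/andP; case: nx ny => ? _ [].
have [nTu ux uy _] := nfc_supp vxy nu; rewrite qend_pcat // in uy.
split.
  split; first by rewrite E' (sorted_splice _ _ xy ux uy).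
  move=> v; rewrite E' mem_cat inE => /or3P[vC|/eqP -> //|vD]; apply: ng.
    by rewrite mem_cat vC.
  by rewrite mem_cat !inE vD !orbT.
have tE : total p (rcons ws q) = total0 (C ++ x :: y :: D) p by rewrite -E.
have tE' : total p' (rcons ws' q') = total0 (C ++ u :: D) p by rewrite -E'.
have [Txy|nTxy] := classic (TipI (pcat x y)).
  left; rewrite tE tE'; apply: total_splice_lt => //.
  - by apply/allP => v /ng [].
  - by case: nTu.
  - exact: nfc_tip.
right; move: nu; rewrite nfc_NonTip //; have [uE _|] := eqVneq u (pcat x y); last by rewrite eqxx.
by split=> //; rewrite tE tE' uE total_splice.
Qed.

(* The i-th face of the bar differential, read on the sequence p, w_1, ..., w_n, q,
   replaces the i-th pair of neighbours by a path in the normal form of its product. *)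
Lemma arrow_support (a : qbarr V Ar) p q p' q' : qb_arrow a -> (1 < size a.1.1)%N ->
  NonTip p -> NonTip q ->
  coef (act (weight_of a) [:: (1, (p, q))]%R) (p', q') != 0%R ->
  exists ws' C x y u D,
    [/\ atgt a = inr ws', p :: rcons a.1.1 q = C ++ x :: y :: D,
        p' :: rcons ws' q' = C ++ u :: D, size C = a.1.2 & nfc (pcat x y) u != 0%R].
Proof.
case: a => [[[|w [|b ws]] i] tg] // [_ H] _ np nq /=.
rewrite coef_act1 /atgt /=; set ws1 := b :: ws.
have oneP x x' : NonTip x -> coef (nf [:: (1%R, x)]) x' != 0%R -> x' = x.
  move=> nx; rewrite -/(nfc _ _) nfc_NonTip //; by case: (x' =P x) => // _; rewrite eqxx.
case: H => [[-> ->]|[[-> ->]|[i0 isz [u [nu ->]]]]].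
- rewrite /= Amul_single Amul_oneA_l mul1r mulf_eq0 negb_or => /andP[Hp /(oneP _ _ nq) ->].
  exists ws1, [::], p, w, p', (rcons ws1 q); split=> //.
  by case: ifP Hp => // _; rewrite coef_nf_nil eqxx.
- rewrite /= eqxx /= Amul_single Amul_oneA_r !mulf_eq0 !negb_or => /andP[/andP[_ /(oneP _ _ np) ->] Hq].
  exists (belast w ws1), (p :: belast w ws1), (last w ws1), q, q', [::]; split=> //.
  + change (p :: rcons (w :: ws1) q = p :: (belast w ws1 ++ [:: last w ws1; q])).
    by rewrite (lastI w ws1) -!cats1 -catA.
  + by rewrite -cats1.
  + by rewrite /= size_belast.
  + by case: ifP Hq => // _; rewrite coef_nf_nil eqxx.
set ws0 := w :: ws1 in isz *.
have i00 : (i == 0%N) = false by rewrite eqn0Ngt i0.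
have isz0 : (i == size ws0) = false by rewrite ltn_eqF.
rewrite i00 isz0 /= Amul_oneA_r Amul_oneA_l !mulf_eq0 !negb_or.
move=> /andP[/andP[_ /(oneP _ _ np) ->] /(oneP _ _ nq) ->].
exists (take i.-1 ws0 ++ u :: drop i.+1 ws0), (p :: take i.-1 ws0),
  (nth w ws0 i.-1), (nth w ws0 i), u, (rcons (drop i.+1 ws0) q).
have i1 : (i.-1 < size ws0)%N by rewrite prednK // ltnW.
split=> //=; last 2 first.
- by rewrite rcons_cat.
- by rewrite size_takel ?prednK // ltnW.
- change (p :: rcons ws0 q = p :: (take i.-1 ws0 ++
    [:: nth w ws0 i.-1, nth w ws0 i & rcons (drop i.+1 ws0) q])).
  rewrite -[in LHS](cat_take_drop i.-1 ws0) (drop_nth w) // prednK // (drop_nth w) //.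
  by rewrite rcons_cat.
Qed.

(** Otherwise the piece [pcat w' z'] would lie inside the chain [rcons A w] and extend [A'],
    although [A'] is the longest chain prefix. *)
Lemma chain_prefix_lt A w R A' w' z' B' : chain None (rcons A w) ->
  matchable A' w' z' B' -> rcons A w ++ R = A' ++ pcat w' z' :: B' ->
  (size A < size A')%N.
Proof.
move=> cAw m' E; rewrite ltnNge; apply/negP => AA'.
have [|F [AwE wzE]] := cat_eq_prefix (esym E); first by rewrite size_rcons ltnW.
case: F AwE wzE => [|v F] AwE.
  by move: AA'; rewrite -ltnS -(size_rcons A w) AwE cats0 ltnn.
case=> wzE _; have /andP[_ /negP[]] := matchable_tgt m'.
by move: cAw; rewrite AwE chain_cat /= -wzE => /and3P[].
Qed.

Lemma zigzag_progress A w z B p q a p' q' : matchable A w z B ->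
  good p (A ++ pcat w z :: B) q -> qb_arrow a -> ~ M a ->
  asrc a = inr (A ++ w :: z :: B) ->
  coef (act (weight_of a) [:: (1, (p, q))]%R) (p', q') != 0%R ->
  exists ws', [/\ atgt a = inr ws', size ws' = size (A ++ pcat w z :: B), good p' ws' q' &
    lt (total p' (rcons ws' q')) (total p (rcons (A ++ pcat w z :: B) q)) \/
    total p' (rcons ws' q') = total p (rcons (A ++ pcat w z :: B) q) /\
    forall A' w' z' B', matchable A' w' z' B' -> ws' = A' ++ pcat w' z' :: B' ->
      (size p.2 < size p'.2)%N \/ p' = p /\ (size A < size A')%N].
Proof.
move=> m g qa nMa aE; have [pt wz [w0 z0] cA nw] := m.
have [psrc cAw novz] := matchable_src m.
have a1E : a.1.1 = A ++ w :: z :: B by case: aE.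
have gsrc : good p (A ++ w :: z :: B) q.
  case: g => sg ng; split.
    move: sg; rewrite !rcons_cat -!cat_cons (sorted_splice _ _ wz) ?qend_pcat //.
  move=> x; rewrite inE mem_rcons inE => /or3P[/eqP ->|/eqP ->|/(proj1 psrc)[]] //.
    by apply: ng; rewrite inE eqxx.
  by apply: ng; rewrite inE mem_rcons inE eqxx orbT.
have totE : total p (rcons (A ++ w :: z :: B) q) = total p (rcons (A ++ pcat w z :: B) q).
  by rewrite !rcons_cat; apply: esym (total_splice (p :: A) w z (rcons B q) p).
have np : NonTip p by case: g => _; apply; rewrite inE eqxx.
have nq : NonTip q by case: g => _; apply; rewrite inE mem_rcons inE eqxx orbT.
have szsrc : (1 < size a.1.1)%N by rewrite a1E size_cat /= !addnS.
case/(arrow_support qa szsrc np nq) => ws' [C [x [y [u [D [atE E E' szC nu]]]]]].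
rewrite a1E in E.
have [g' tot'] := good_splice gsrc E E' nu; rewrite totE in tot'.
exists ws'; split=> //.
  have := congr1 size E; have := congr1 size E'.
  rewrite /= !size_rcons !size_cat /= !addnS => -[<-] [E1].
  by apply/eqP; rewrite -(eqn_add2r 1) !addn1 E1.
case: tot' => [lt'|[tE uE nTu]]; [by left | right; split=> // A' w' z' B' m' wsE].
have ntxy : tipb (pcat x y) = false by rewrite -uE NonTip_tipb.
(* The face of index 0 multiplies the first piece into [p], which becomes longer. *)
have [i0|i0] := posnP (size C).
  left; case: C i0 E E' szC => // _ [pE E2] [p'E _] _.
  have y0 : (0 < size y.2)%N.
    have yin : y \in A ++ w :: z :: B.
      case: (A) E2 => [|v A1] /= [<- _]; first by rewrite inE eqxx.
      by rewrite inE eqxx.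
    by case: (proj1 psrc y yin).
  by rewrite p'E uE size_cat pE -[X in (X < _)%N]addn0 ltn_add2l.
right; case: C i0 E E' szC => [//|c C] _ [<- E] [p'p E'] /= szC; split=> //.
(* Two neighbours inside the chain [rcons A w] have their product in Tip(I), which is excluded
   here. *)
have [CA|AC] := ltnP (size C) (size A).
  have E1 : (C ++ [:: x; y]) ++ D = rcons A w ++ z :: rcons B q.
    by rewrite -catA /= -E cat_rcons rcons_cat.
  have [|F [AwE _]] := cat_eq_prefix E1.
    by rewrite size_cat size_rcons addn2 ltnS.
  move: cAw; rewrite AwE !chain_cat => /andP[/andP[_ /= /and3P[_ /andP[/= ov _] _]] _].
  by rewrite ntxy in ov.
have [|F [CE FE]] := @cat_eq_prefix _ A (w :: z :: rcons B q) C (x :: y :: D) _ AC.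
  by rewrite -E rcons_cat.
case: F CE FE => [|f F] CE.
(* Merging w with z is the matched arrow itself, which is not thick. *)
- case=> wx zy DE; case: nMa; apply/matchingP; exists A, w, z, B; split=> //.
  have /rcons_inj[ws'E _] : rcons ws' q' = rcons (A ++ pcat w z :: B) q.
    by rewrite E' CE cats0 uE -wx -zy -DE rcons_cat.
  rewrite /matched -ws'E; case: (a) a1E atE szC => [[src i] tg] /=; rewrite /atgt /=.
  by move=> -> -> <-; rewrite CE cats0.
(* A face further right keeps the chain [rcons A w] as a prefix. *)
- case=> wf _; subst f.
  have E2 : C ++ u :: D = ws' ++ [:: q'] by rewrite cats1.
  have [|R [ws'R _]] := cat_eq_prefix E2.
    by have := congr1 size E'; rewrite size_rcons size_cat /= addnS => -[->]; rewrite leq_addr.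
  apply: (@chain_prefix_lt _ w (F ++ R) _ _ _ _ cAw m').
  by rewrite -wsE ws'R CE cat_rcons -catA.
Qed.

Lemma finite_out_arrows ws : exists R : seq (qbarr V Ar),
  forall a, qb_arrow a -> asrc a = inr ws -> a \in R.
Proof.
case: ws => [|w ws].
  by exists [::] => -[[ws1 i] tg] [_ H] [E]; rewrite E in H.
set ws1 := w :: ws.
pose tgts i : seq (qbv V Ar) :=
  [:: (if ws is [::] then inl (qend w) else inr ws),
      (if ws is [::] then inl w.1 else inr (belast w ws)) &
      [seq inr (take i.-1 ws1 ++ e.2 :: drop i.+1 ws1)
        | e <- nf [:: (1%R, pcat (nth w ws1 i.-1) (nth w ws1 i))]]].
exists [seq (ws1, i, tg) | i <- iota 0 (size ws1).+1, tg <- tgts i].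
move=> [[ws2 i] tg] [_ H] [E]; rewrite {}E in H *.
apply/allpairsPdep; exists i, tg; rewrite mem_iota add0n ltnS.
case: H => [[-> ->]|[[-> ->]|[i0 isz [u [nu ->]]]]].
- by split=> //; rewrite /tgts inE eqxx.
- by rewrite leqnn; split=> //; rewrite /tgts !inE eqxx orbT.
- rewrite /tgts !inE (ltnW isz); split=> //; apply/orP; right; apply/orP; right.
  have /mapP[c cin uE] := coef_neq0 nu.
  by apply/mapP; exists c; rewrite // uE.
Qed.

Definition finite_zigzags p (b : qbv V Ar) q : Prop :=
  exists Z : seq (seq (qbarr V Ar * qbarr V Ar)),
  forall zg c, zigzag_from s t lt I M b zg c ->
    ~ lnull (lin zg [:: (1%R, (p, q))]) -> zg \in Z.

(** The first dotted arrow is forced, because a vertex is the target of at most one matched arrow.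
    It is followed by one of finitely many thick arrows and finitely many basis elements in the
    image. *)
Lemma finite_zigzags_step A w z B p q : matchable A w z B ->
  (forall a p' q', qb_arrow a -> ~ M a -> asrc a = inr (A ++ w :: z :: B) ->
     coef (act (weight_of a) [:: (1, (p, q))]%R) (p', q') != 0%R ->
     finite_zigzags p' (atgt a) q') ->
  finite_zigzags p (inr (A ++ pcat w z :: B)) q.
Proof.
move=> m IH; set m0 := matched A w z B.
have [R HR] := finite_out_arrows (A ++ w :: z :: B).
pose Q a zg := exists zg' c, [/\ zg = (m0, a) :: zg', qb_arrow a /\ ~ M a,
  asrc a = inr (A ++ w :: z :: B), zigzag_from s t lt I M (atgt a) zg' c
  & ~ lnull (lin zg [:: (1%R, (p, q))])].
have [a aR|Z HZ] := @finite_union _ _ R Q.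
  have [[qa nMa aE]|nok] :=
    classic [/\ qb_arrow a, ~ M a & asrc a = inr (A ++ w :: z :: B)]; last first.
    by exists [::] => zg [zg' [c [_ [qa nMa] aE]]]; case: nok.
  pose Y := act (weight_of a) [:: (1%R, (p, q))].
  pose Q' d zg := exists zg' c, [/\ zg = (m0, a) :: zg', coef Y d != 0%R,
    zigzag_from s t lt I M (atgt a) zg' c & ~ lnull (lin zg' [:: (1%R, d)])].
  have [d _|Z HZ] := @finite_union _ _ [seq c.2 | c <- Y] Q'.
    have [d0|d0] := eqVneq (coef Y d) 0%R.
      by exists [::] => zg [zg' [c [_]]]; rewrite d0 eqxx.
    have [Z HZ] : finite_zigzags d.1 (atgt a) d.2.
      by apply: IH => //; rewrite -surjective_pairing.
    exists [seq (m0, a) :: zg' | zg' <- Z] => zg [zg' [c [-> _ zc nz]]].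
    by apply/map_f/(HZ _ c) => //; rewrite -surjective_pairing.
  exists Z => zg [zg' [c [zgE _ _ zc]]]; rewrite {1}zgE => nz.
  have [e ne] : exists e, coef (lin zg' (act (weight_of a)
      (lscale (- (wc (weight_of m0))^-1)%R [:: (1%R, (p, q))]))) e != 0%R.
    apply: NNPP => none; apply: nz => e; apply/eqP/negPn/negP => ne.
    by apply: none; exists e.
  have [d [Yd zd]] := coef_lin_neq0 ne.
  have {}Yd : coef Y d != 0%R.
    by move: Yd; rewrite coef_act /= big_seq1 mulf_eq0 negb_or => /andP[].
  apply: (HZ d); first exact: coef_neq0.
  by exists zg', c; split=> // /(_ e) z0; rewrite z0 eqxx in zd.
exists ([::] :: Z) => -[|[m1 a] zg] c; first by rewrite inE eqxx.
case=> -[Mm1 m1t] qa nMa aE zc nz; rewrite inE; apply/orP; right.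
have [A' [w' [z' [B' [m1E m1m]]]]] := (iffLR (matchingP _)) Mm1.
have {}m1E : m1 = m0.
  move: m1t; rewrite m1E => -[]; rewrite /atgt /= => /(matched_tgt_inj m1m m)[-> -> -> ->].
  by [].
rewrite m1E in aE nz *; apply: (HZ a); first exact: HR.
by exists zg, c.
Qed.

Lemma finite_zigzags_unmatched p ws q :
  (forall A w z B, matchable A w z B -> ws <> A ++ pcat w z :: B) ->
  finite_zigzags p (inr ws) q.
Proof.
move=> um; exists [:: [::]] => -[|[m a] zg] c //.
case=> -[/matchingP[A [w [z [B [-> mt]]]]]]; rewrite /atgt /= => -[E].
by case: (um _ _ _ _ mt).
Qed.

(* Along a zigzag the total path never increases; when it is constant, either
   the left coefficient p gets longer or it is kept and the chain prefix does. *)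
Lemma good_finite_zigzags p ws q : good p ws q -> finite_zigzags p (inr ws) q.
Proof.
suff main T : valid T -> forall p ws q, good p ws q -> total p (rcons ws q) = T ->
    finite_zigzags p (inr ws) q.
  by move=> g; apply: (main _ (good_total_valid g)).
move: T; apply: lt_ind => T vT IHT.
(* For fixed T this encodes the lexicographic order on (length of p, length of A); the degree is
   constant along a zigzag, and the factor [(size ws).+1] dominates the second term. *)
pose mu p ws A := ((size T.2 - size p.2) * (size ws).+1 + (size ws - size A))%N.
(* The bound is imposed on matched decompositions of [ws], so N = 0 means that no dotted arrow
   starts there. *)
suff main N : forall p ws q, good p ws q -> total p (rcons ws q) = T ->
    (forall A w z B, matchable A w z B -> ws = A ++ pcat w z :: B -> (mu p ws A < N)%N) ->
    finite_zigzags p (inr ws) q.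
  move=> {}p {}ws {}q g tE; apply: (main (mu p ws [::]).+1 _ _ _ g tE) => A w z B _ _.
  by rewrite /mu ltnS leq_add2l leq_sub2l.
elim: N => [|N IHN] {}p {}ws {}q g tE bd.
  by apply: finite_zigzags_unmatched => A w z B m /(bd _ _ _ _ m).
have [[A [w [z [B [m wsE]]]]]|dead] := classic (exists A w z B,
    matchable A w z B /\ ws = A ++ pcat w z :: B); last first.
  by apply: finite_zigzags_unmatched => A w z B m wsE; apply: dead; exists A, w, z, B.
rewrite wsE in g tE bd *.
apply: (finite_zigzags_step m) => a p' q' qa nMa aE nz.
have [ws' [-> szws' g' prog]] := zigzag_progress m g qa nMa aE nz.
rewrite tE in prog; case: prog => [ltT|[tE' prog]].
  by apply: (IHT _ _ ltT _ _ _ g') => //; apply: good_total_valid g'.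
apply: (IHN _ _ _ g' tE') => A' w' z' B' m' ws'E.
rewrite -ltnS; apply: leq_trans (bd _ _ _ _ m erefl); rewrite ltnS /mu -szws'.
have A'ws' : (size A' < size ws')%N.
  by rewrite ws'E size_cat /= addnS ltnS leq_addr.
have p'T : (size p'.2 <= size T.2)%N by rewrite -tE' size_cat leq_addr.
case: (prog _ _ _ _ m' ws'E) => [pp'|[-> AA']]; last first.
  by rewrite ltn_add2l ltn_sub2l // (ltn_trans AA').
apply: (@leq_trans ((size T.2 - size p'.2).+1 * (size ws').+1)).
  by rewrite mulSn addnC ltn_add2r ltnS leq_subr.
apply: leq_trans (leq_addr _ _); rewrite leq_mul2r /=.
by rewrite ltn_sub2l // (leq_trans pp').
Qed.

(** A dotted arrow acts as a scalar on elements of its own summand; the induction therefore carries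
    membership in the current summand. *)
Lemma zz_val_lin zg b c Y : zigzag_from s t lt I M b zg c -> summ b Y ->
  coef (zz_val zg Y) =1 coef (lin zg Y).
Proof.
elim: zg b Y => [//|[m a] zg IH] b Y [[/matchingP[A [w [z [B [-> mt]]]]] <-] qa nMa aE zc] sY.
have dotE := coef_dot_act mt sY.
set Y' := lscale _ Y in dotE.
have stepE : coef (act (weight_of a) (dot_act (matched A w z B) Y))
    =1 coef (act (weight_of a) Y') by apply: eq_coef_act.
move=> d; rewrite /Defs.zz_val /= -/(zz_val _ _) /lin /= -/(lin _ _).
rewrite -(eq_coef_lin zg stepE).
(* If another dotted arrow follows, the new value must be shown to lie in the summand of the vertex
   just reached. *)
case: zg IH zc => [//|mr zg] IH zc; apply: (IH _ _ zc).
case: mr zc {IH} => [m2 a2] [[M2 m2t] _ _ _ _].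
have [pt _ _ _ _] := mt.
case/matchingP: M2 m2t => A2 [w2 [z2 [B2 [-> mt2]]]]; rewrite {1}/atgt /= => m2t.
rewrite -m2t; apply: good_summ; last by case: (A2).
move=> p' q'; rewrite stepE => /coef_act_neq0[[p q] [Ypq pq]].
have gpq : good p (A ++ pcat w z :: B) q.
  apply: (summ_good pt sY); move: Ypq.
  by rewrite coef_scale mulf_eq0 negb_or => /andP[].
have [ws' [aE' _ g' _]] := zigzag_progress mt gpq qa nMa aE pq.
by move: m2t; rewrite aE' => -[->].
Qed.

Lemma zigzag_from_end b zg c : zigzag_from s t lt I M b zg c ->
  c = last b [seq atgt mr.2 | mr <- zg].
Proof. by elim: zg b => [|[m a] zg IH] b /=; [|case=> _ _ _ _ /IH]. Qed.

(** * The matching property and the finiteness required by the Morse condition *)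

Lemma M_partial_matching : partial_matching s t lt I M.
Proof.
split=> [a Ma|a b Ma Mb].
  split; first by case: Ma.
  by case/matchingP: Ma => A [w [z [B [-> m]]]]; apply: matched_invertible.
case/matchingP: Ma => A [w [z [B [-> m]]]].
case/matchingP: Mb => A' [w' [z' [B' [-> m']]]].
rewrite /asrc /atgt /=; case=> [[]|[[]|[[]|[]]]].
- by case/(matched_src_inj m m') => -> -> -> ->.
- by move/(matched_src_tgt m m').
- by move/esym/(matched_src_tgt m' m).
- by case/(matched_tgt_inj m m') => -> -> -> ->.
Qed.

(** A zigzag with nonzero value on X is nonzero on some basis element in the support of X, and each
    of these finitely many elements admits only finitely many such zigzags. *)
Lemma M_finite_sums m X : M m -> summ (atgt m) X ->
  exists Z : seq (seq (qbarr V Ar * qbarr V Ar)), forall zg c,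
    zigzag_from s t lt I M (atgt m) zg c -> ~ lnull (zz_val zg X) -> zg \in Z.
Proof.
case/matchingP=> A [w [z [B [-> mt]]]]; rewrite /atgt /= => sX.
have [pt _ _ _ _] := mt.
pose Q d zg := exists c,
  [/\ zigzag_from s t lt I M (inr (A ++ pcat w z :: B)) zg c,
      coef X d != 0%R & ~ lnull (lin zg [:: (1%R, d)])].
have [[p q] _|Z HZ] := @finite_union _ _ [seq c.2 | c <- X] Q.
  have [X0|Xpq] := eqVneq (coef X (p, q)) 0%R.
    by exists [::] => zg [c [_]]; rewrite X0 eqxx.
  have [Z HZ] := good_finite_zigzags (summ_good pt sX Xpq).
  by exists Z => zg [c [zc _]]; apply: HZ zc.
exists Z => zg c zc nz.
have [e ne] : exists e, coef (lin zg X) e != 0%R.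
  apply: NNPP => none; apply: nz => e; rewrite (zz_val_lin zc sX).
  by apply/eqP/negPn/negP => ne; apply: none; exists e.
have [d [Xd zd]] := coef_lin_neq0 ne.
apply: (HZ d); first exact: coef_neq0.
by exists c; split=> // /(_ e) z0; rewrite z0 eqxx in zd.
Qed.

End BarResolution.

Theorem theorem4p3 (k : fieldType) (V Ar : finType) (s t : Ar -> V)
    (lt : rel (V * seq Ar)) (I G : (V * seq Ar -> k) -> Prop) :
  admissible_order s t lt ->
  two_sided_ideal s t I ->
  reduced_GS_basis s t lt I G ->
  morse_matching s t lt I (matchingM s t lt I G) /\
  forall (n : nat) (v : qbv V Ar), qb_vert s t lt I v -> qdeg v = n ->
    (critical s t lt I (matchingM s t lt I G) v <-> in_W_chains s t lt I G n v).
Proof.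
move=> lt_adm I_ideal G_basis; split.
  split=> [|m X Mm sX]; first exact: M_partial_matching.
  have [Z HZ] := M_finite_sums lt_adm I_ideal G_basis Mm sX.
  (* The finite list [Z] is sorted by end vertex: [F c] keeps its members that are zigzags ending at
     [c]. *)
  pose zb c g := if excluded_middle_informative
    (zigzag s t lt I (matchingM s t lt I G) (atgt m) c g) then true else false.
  have zbP c g : reflect (zigzag s t lt I (matchingM s t lt I G) (atgt m) c g) (zb c g).
    by rewrite /zb; case: excluded_middle_informative => H; constructor.
  exists (fun c => [seq g <- Z | zb c g]); split.
  - by move=> c g; rewrite mem_filter => /andP[/zbP].
  - move=> c g zcg nz; rewrite mem_filter; apply/andP; split; first exact/zbP.
    by case: zcg => _ zc; apply: HZ zc nz.
  (* Outside the finitely many end vertices of members of [Z], the list [F c] is empty and the sum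
     is zero. *)
  exists [seq last (atgt m) [seq atgt mr.2 | mr <- g] | g <- Z] => c cZ.
  suff -> : [seq g <- Z | zb c g] = [::] by move=> x; rewrite /coef big_nil.
  apply/eqP; rewrite -(negbK (_ == _)) -has_filter; apply/hasPn => g gZ.
  apply: contra cZ => /zbP[_ /zigzag_from_end ->].
  by apply/mapP; exists g.
move=> n [e|ws] qv <-.
  (* Matched arrows join sequences of positive degree, so every vertex of degree 0 is critical. *)
  by split=> // _; split=> // a; case/matchingP => // A [w [z [B [-> _]]]].
have [ws0 pws] := (iffLR (piecesP _ _ _ _ _)) qv.
have crit := criticalP lt_adm I_ideal G_basis pws ws0.
have chn := is_chainP lt_adm I_ideal G_basis pws ws0.
have -> : in_W_chains s t lt I G (qdeg (inr ws)) (inr ws) =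
    is_chain s t lt I G (size ws).-1 ws by case: (ws) ws0.
split=> [[_ /crit /chn]|/chn /crit] //.
Qed.
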